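(* Suppose $T$ is NIP, $G$ is dfg, and $t\in S_G^{\mathrm{inv}}(\mathcal{U},M)$ is right dfg over $M$. Then $t*S_G^{\mathrm{inv}}(\mathcal{U},M)$ is an Ellis subgroup of $S_G^{\mathrm{inv}}(\mathcal{U},M)$, its image under $K_M$ is an Ellis subgroup of $S_G^{\mathrm{fs}}(\mathcal{U},M)$, and $K_M|_{t*S_G^{\mathrm{inv}}(\mathcal{U},M)}$ is an anti-isomorphism between them.
   Context: $\mathcal{U}$ monster model of $T$, $M\prec\mathcal{U}$ small, $G$ a group definable over $\emptyset$. $S_G^{\mathrm{inv}}(\mathcal{U},M)$ (resp. $S_G^{\mathrm{fs}}(\mathcal{U},M)$): global types on $G$ which are $M$-invariant (resp. finitely satisfiable in $M$). Newelski product: $\varphi(x,d)\in p*q$ iff $\varphi(x\cdot b,d)\in p$ where $b\models q|_{Md}$; both spaces are compact Hausdorff semigroups. Right translate: $\varphi(x)\in p\cdot c\iff\varphi(x\cdot c)\in p$. $p^{-1}=\mathrm{tp}(a^{-1}/\mathcal{U})$ for $a\models p$. A type is right dfg over $M$ if it and all its right translates by elements of $G(\mathcal{U})$ are definable over $M$; $G$ is dfg if some type is right dfg over $M$. Ellis subgroup: $u*I$ for $I$ a minimal left ideal and $u\in I$ idempotent. Anti-isomorphism: bijection $f$ with $f(ab)=f(b)f(a)$. Retraction $F_M$ (NIP): add predicate $\mathbf{P}$ for $M$, take a $|\mathcal{U}|^+$-saturated $(N',N)\succ(\mathcal{U},M)$; for $M$-invariant $p$ let $p|_N$ be the restriction to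 $N$ of its $M$-invariant extension to $N'$; $\theta(x,b)\in F_M(p)$ iff $\{\theta(x,b),\mathbf{P}(x)\}\cup p|_N$ is consistent. $K_M(p):=F_M(p^{-1})$. *)

(* Defs.v *)
From mathcomp Require Import all_boot.
From mathcomp Require Import boolp classical_sets functions cardinality.

Set Implicit Arguments.
Unset Strict Implicit.
Unset Printing Implicit Defensive.

Local Open Scope classical_set_scope.
Local Open Scope card_scope.

(** * First-order syntax and semantics *)

Record language := Language {
  fsym : Type;
  far : fsym -> nat;
  rsym : Type;
  rar : rsym -> nat }.

Inductive term (L : language) (V : Type) : Type :=
| Tvar of V
| Tapp (f : fsym L) of ('I_(far f) -> term L V).

(* [formula L V]: L-formulas whose free variables are in V; [Fex] binds the
   variable [None].  An L(A)-formula in the variables x_0, ..., x_(n-1) is an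
   element of [formula L ('I_n + A)]. *)
Inductive formula (L : language) (V : Type) : Type :=
| Feq of term L V & term L V
| Frel (r : rsym L) of ('I_(rar r) -> term L V)
| Fnot of formula L V
| Fand of formula L V & formula L V
| Fex of formula L (option V).

Arguments Tvar {L V}.

Definition sentence (L : language) := formula L void.

Fixpoint tren (L : language) (V W : Type) (h : V -> W) (s : term L V) :
    term L W :=
  match s with
  | Tvar v => Tvar (h v)
  | Tapp f args => @Tapp L W f (fun i => tren h (args i))
  end.

Fixpoint fren (L : language) (V W : Type) (h : V -> W) (phi : formula L V) :
    formula L W :=
  match phi with
  | Feq s1 s2 => Feq (tren h s1) (tren h s2)
  | Frel r args => @Frel L W r (fun i => tren h (args i))
  | Fnot psi => Fnot (fren h psi)
  | Fand psi1 psi2 => Fand (fren h psi1) (fren h psi2)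
  | Fex psi => Fex (fren (omap h) psi)
  end.

(* The block of quantifiers "exists z_0 ... z_(n-1)". *)
Fixpoint Fexn (L : language) (n : nat) :
    forall V : Type, formula L (V + 'I_n) -> formula L V :=
  match n with
  | 0 => fun V phi =>
      fren (fun s : V + 'I_0 => match s with
            | inl v => v
            | inr i => False_rect V (notF (ltn_ord i))
            end) phi
  | m.+1 => fun V phi =>
      Fex (Fexn (fren (fun s : V + 'I_m.+1 => match s with
            | inl v => inl (Some v)
            | inr i => if unlift ord0 i is Some i' then inr i' else inl None
            end) phi))
  end.

Record structure (L : language) := Structure {
  carrier :> Type;
  carrier_inhabited : inhabited carrier;
  fint : forall f : fsym L, ('I_(far f) -> carrier) -> carrier;
  rint : forall r : rsym L, ('I_(rar r) -> carrier) -> Prop }.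

Fixpoint teval (L : language) (N : structure L) (V : Type) (v : V -> N)
    (s : term L V) : N :=
  match s with
  | Tvar x => v x
  | Tapp f args => fint (fun i => teval v (args i))
  end.

Definition scons (N V : Type) (c : N) (v : V -> N) (o : option V) : N :=
  if o is Some x then v x else c.

Fixpoint sat (L : language) (N : structure L) (V : Type) (phi : formula L V) :
    (V -> N) -> Prop :=
  match phi with
  | Feq s1 s2 => fun v => teval v s1 = teval v s2
  | Frel r args => fun v => rint (fun i => teval v (args i))
  | Fnot psi => fun v => ~ sat psi v
  | Fand psi1 psi2 => fun v => sat psi1 v /\ sat psi2 v
  | Fex psi => fun v => exists c : N, sat psi (scons c v)
  end.

Definition model_of (L : language) (T : set (sentence L)) (N : structure L) :=
  forall sigma, T sigma -> sat sigma (of_void N).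

Definition elementary (L : language) (N N' : structure L) (j : N -> N') :=
  forall (V : Type) (phi : formula L V) (v : V -> N),
    sat phi v <-> sat phi (j \o v).

Definition elem_substructure (L : language) (N : structure L) (A : set N) :=
  exists (S : structure L) (i : S -> N), elementary i /\ range i = A.

Definition automorphism (L : language) (N : structure L) (s : N -> N) :=
  [/\ bijective s,
      forall (f : fsym L) (a : 'I_(far f) -> N),
        s (fint a) = fint (s \o a) &
      forall (r : rsym L) (a : 'I_(rar r) -> N),
        rint a <-> rint (s \o a)].

(** * Formulas over a structure, partial types *)

Section PartialTypes.
Variables (L : language) (N : structure L) (n : nat).
Implicit Types (phi : formula L ('I_n + N)) (S : set (formula L ('I_n + N))).

Definition holds phi (a : 'I_n -> N) : Prop :=
  sat phi (fun s => match s with inl i => a i | inr c => c end).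

(* phi(x, d), for phi(x, y) without parameters *)
Definition inst (m : nat) (phi : formula L ('I_n + 'I_m)) (d : 'I_m -> N) :
    formula L ('I_n + N) :=
  fren (fun s => match s with inl i => inl i | inr i => inr (d i) end) phi.

Definition over (A : set N) : set (formula L ('I_n + N)) :=
  [set phi | exists (m : nat) (psi : formula L ('I_n + 'I_m)) (d : 'I_m -> N),
      (forall i, A (d i)) /\ phi = inst psi d].

Definition realizes (a : 'I_n -> N) S := forall phi, S phi -> holds phi a.

Definition fin_sat_in (A : set N) S :=
  forall S0, finite_set S0 -> S0 `<=` S ->
    exists a : 'I_n -> N, (forall i, A (a i)) /\ realizes a S0.

Definition complete_type S :=
  fin_sat_in setT S /\ forall phi, S phi \/ S (Fnot phi).

Definition equiv_over (A : set N) (b c : 'I_n -> N) :=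
  forall phi, over A phi -> (holds phi b <-> holds phi c).

End PartialTypes.

(* Saturation with respect to a class [sm] of parameter sets. *)
Definition saturated (L : language) (N : structure L) (sm : set (set N)) :=
  forall A : set N, sm A ->
  forall (n : nat) (S : set (formula L ('I_n + N))),
    S `<=` over A -> fin_sat_in setT S -> exists a, realizes a S.

(** * Monster models, NIP *)

(* |A| < |kappa|; cardinals are represented by types. *)
Definition small (kappa X : Type) (A : set X) : Prop :=
  A #<= [set: kappa] /\ ~ ([set: kappa] #<= A).

Definition strongly_homogeneous (kappa : Type) (L : language)
    (U : structure L) :=
  forall (A : set U) (f : U -> U), small kappa A ->
    (forall (n : nat) (phi : formula L 'I_n) (a : 'I_n -> U),
        (forall i, A (a i)) -> (sat phi a <-> sat phi (f \o a))) ->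
    exists s : U -> U, automorphism s /\ forall x, A x -> s x = f x.

Record monster_model (kappa : Type) (L : language) (T : set (sentence L))
    (U : structure L) : Prop := MonsterModel {
  monster_aleph0 : small kappa [set: nat];
  monster_fsym : small kappa [set: fsym L];
  monster_rsym : small kappa [set: rsym L];
  monster_model_of : model_of T U;
  monster_saturated : saturated (fun A : set U => small kappa A);
  monster_homogeneous : strongly_homogeneous kappa U }.

Definition shattered (L : language) (N : structure L) (m n : nat)
    (phi : formula L ('I_m + 'I_n)) (A : set ('I_m -> N)) :=
  forall B, B `<=` A -> exists b : 'I_n -> N, forall a, A a ->
    (sat phi (fun s => match s with inl i => a i | inr i => b i end) <-> B a).

Definition NIP (L : language) (T : set (sentence L)) :=
  forall N : structure L, model_of T N ->
  forall (m n : nat) (phi : formula L ('I_m + 'I_n)) (A : set ('I_m -> N)),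
    infinite_set A -> ~ shattered phi A.

(** * Invariant and definable types *)

Section Types.
Variables (L : language) (U : structure L) (k : nat).
Implicit Types (A : set U) (p : set (formula L ('I_k + U))).

Definition invariant A p :=
  forall (n : nat) (phi : formula L ('I_k + 'I_n)) (b c : 'I_n -> U),
    equiv_over A b c -> (p (inst phi b) <-> p (inst phi c)).

Definition definable_over A p :=
  forall (n : nat) (phi : formula L ('I_k + 'I_n)),
    exists psi : formula L ('I_n + U), over A psi /\
      forall b : 'I_n -> U, p (inst phi b) <-> holds psi b.

Definition restr A p : set (formula L ('I_k + U)) :=
  [set phi | p phi /\ over A phi].

End Types.

(** * Definable groups *)

(* A group whose universe [gdom] is a 0-definable set of k-tuples and whose
   multiplication has the 0-definable graph [gmul]. *)
Record definable_group (L : language) (U : structure L) (k : nat) :=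
  DefinableGroup {
  gdom : formula L 'I_k;
  gmul : formula L ('I_k + 'I_k + 'I_k);
  inG := fun a : 'I_k -> U => sat gdom a;
  mulG := fun a b c : 'I_k -> U =>
    sat gmul (fun s => match s with
      | inl (inl i) => a i | inl (inr i) => b i | inr i => c i end);
  gmul_fun : forall a b, inG a -> inG b ->
    exists c, inG c /\ forall c', mulG a b c' <-> c' = c;
  gmul_assoc : forall a b c ab bc r s, inG a -> inG b -> inG c ->
    mulG a b ab -> mulG b c bc -> mulG ab c r -> mulG a bc s -> r = s;
  gmul_id_inv : exists e, inG e /\ forall a, inG a ->
    [/\ mulG e a a, mulG a e a &
        exists a', [/\ inG a', mulG a a' e & mulG a' a e]] }.

Section Group.
Variables (L : language) (U : structure L) (k : nat).
Variable G : definable_group U k.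
Implicit Types (M : set U) (p q : set (formula L ('I_k + U))).
Implicit Types (phi : formula L ('I_k + U)).

(* phi(x . b), i.e. exists z, x . b = z /\ phi(z) *)
Definition subst_rmul phi (b : 'I_k -> U) : formula L ('I_k + U) :=
  Fexn (Fand
    (fren (fun s => match s with
       | inl (inl i) => inl (inl i)
       | inl (inr i) => inl (inr (b i))
       | inr i => inr i end) (gmul G))
    (fren (fun s => match s with
       | inl i => inr i
       | inr c => inl (inr c) end) phi)).

(* phi(x^-1), i.e. exists z e, z, e in G /\ e . e = e /\ x . z = e /\ phi(z) *)
Definition subst_inv phi : formula L ('I_k + U) :=
  Fexn (Fexn (Fand
    (Fand (fren (fun i => inl (inr i)) (gdom G))
          (fren (fun i => inr i) (gdom G)))
    (Fand
      (Fand
        (fren (fun s => match s with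
           | inl (inl i) => inr i
           | inl (inr i) => inr i
           | inr i => inr i end) (gmul G))
        (fren (fun s => match s with
           | inl (inl i) => inl (inl (inl i))
           | inl (inr i) => inl (inr i)
           | inr i => inr i end) (gmul G)))
      (fren (fun s => match s with
         | inl i => inl (inr i)
         | inr c => inl (inl (inr c)) end) phi)))).

Definition S_G p := complete_type p /\ p (fren inl (gdom G)).

Definition S_inv M : set (set (formula L ('I_k + U))) :=
  [set p | S_G p /\ invariant M p].

Definition S_fs M : set (set (formula L ('I_k + U))) :=
  [set p | S_G p /\ fin_sat_in M p].

Definition newelski M p q : set (formula L ('I_k + U)) :=
  [set Phi | exists (n : nat) (phi : formula L ('I_k + 'I_n)) (d : 'I_n -> U)
      (b : 'I_k -> U),
      [/\ Phi = inst phi d, realizes b (restr (M `|` range d) q) &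
          p (subst_rmul (inst phi d) b)]].

Definition rtranslate p (c : 'I_k -> U) : set (formula L ('I_k + U)) :=
  [set phi | p (subst_rmul phi c)].

Definition type_inv p : set (formula L ('I_k + U)) :=
  [set phi | p (subst_inv phi)].

Definition right_dfg M p :=
  definable_over M p /\
  forall c : 'I_k -> U, sat (gdom G) c -> definable_over M (rtranslate p c).

Definition dfg_group M := exists p, S_G p /\ right_dfg M p.

End Group.

(** * The retraction F_M and the map K_M *)

Definition lang_pred (L : language) : language :=
  @Language (fsym L) (@far L) (option (rsym L))
    (fun r => if r is Some r' then rar r' else 1).

(* The pair (N, P), as a structure in the language with a unary predicate
   (the symbol [None]) added for P. *)
Definition pair_structure (L : language) (N : structure L) (P : set N) :
    structure (lang_pred L) :=
  @Structure (lang_pred L) N (carrier_inhabited N) (@fint L N)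
    (fun r : option (rsym L) =>
      match r return ('I_(@rar (lang_pred L) r) -> N) -> Prop with
      | Some r' => @rint L N r'
      | None => fun a => P (a ord0)
      end).

Definition saturated_pair_extension (L : language) (U : structure L)
    (M : set U) (N' : structure L) (N : set N') (j : U -> N') :=
  @elementary (lang_pred L) (pair_structure M) (pair_structure N) j /\
  @saturated (lang_pred L) (pair_structure N)
    (fun A : set N' => A #<= [set: U]).

Section Retraction.
Variables (L : language) (U : structure L) (M : set U).
Variables (N' : structure L) (N : set N') (j : U -> N') (k : nat).
Implicit Types (p : set (formula L ('I_k + U))).

Definition push (phi : formula L ('I_k + U)) : formula L ('I_k + N') :=
  fren (fun s => match s with inl i => inl i | inr c => inr (j c) end) phi.

Definition inv_extension p (p' : set (formula L ('I_k + N'))) :=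
  [/\ complete_type p', (forall phi, p phi -> p' (push phi)) &
      invariant (j @` M) p'].

Definition inv_restr p : set (formula L ('I_k + N')) :=
  [set psi | exists p' : set (formula L ('I_k + N')),
      inv_extension p p' /\ restr N p' psi].

(* {theta(x, b), P(x)} together with p|_N is consistent with the elementary
   diagram of (N', N) iff its finite parts are realized in (N', N), i.e. iff
   the finite parts of {theta(x, b)} `|` p|_N are realized by tuples from N. *)
Definition F_map p : set (formula L ('I_k + U)) :=
  [set theta | fin_sat_in N (push theta |` inv_restr p)].

Definition K_map (G : definable_group U k) p := F_map (type_inv G p).

End Retraction.

(** * Ellis subgroups *)

Section Semigroup.
Variables (X : Type) (op : X -> X -> X).

Definition left_ideal (S I : set X) :=
  [/\ I `<=` S, I !=set0 & forall s x, S s -> I x -> I (op s x)].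

Definition minimal_left_ideal (S I : set X) :=
  left_ideal S I /\ forall J, left_ideal S J -> J `<=` I -> J = I.

Definition ellis_subgroup (S H : set X) :=
  exists (I : set X) (u : X),
    [/\ minimal_left_ideal S I, I u, op u u = u & H = [set op u x | x in I]].

Definition anti_isomorphism (H K : set X) (f : X -> X) :=
  set_bij H K f /\
  forall x y, H x -> H y -> f (op x y) = op (f y) (f x).

End Semigroup.

(* Main.v *)
From HB Require Import structures.
From mathcomp Require Import all_boot.
From mathcomp Require Import boolp classical_sets functions cardinality.
Require Import Defs.

(** A complete type is viewed as an ultrafilter on definable sets.

    If t is right dfg over M, every translate t.c is definable over M, so it
    depends only on tp(c/M); hence t * q = t.c for any c |= q|_M, and
    t * S^inv is the orbit {t.g | g in G(U)}.  Fixing a0 |= t|_M, the product on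
    the orbit is (t.b) * (t.c) = t.(b a0 c), a group law with unit
    u = t.a0^-1.  A right ideal which is a group with unit u is the Ellis
    subgroup u * (S^inv * u).

    For a type r definable over M, membership in F_M(r) is an elementary
    property of the pair (N', N), so it can be read off in (U, M): F_M(r) is
    generated by the traces on M of the formulas of r|_M.  NIP makes it
    complete, i.e. r|_M has a unique coheir.  For s in S^fs and p in the orbit,
    s * K_M(p) and K_M(p.g^-1) with g |= s|_M are both coheirs of the same type
    over M, so they are equal.  Taking s = K_M(q) gives
    K_M(q) * K_M(p) = K_M(p * q), and arbitrary s shows that the image of the
    orbit is a left ideal; being a group, it is an Ellis subgroup.  Injectivity
    holds because K_M(p) determines p^-1 over M, hence p by definability. *)

Set Implicit Arguments.
Unset Strict Implicit.
Unset Printing Implicit Defensive.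

Local Open Scope classical_set_scope.
Local Open Scope card_scope.

(** * Cardinality and directed families *)

Lemma countable_setU (T : Type) (A B : set T) :
  countable A -> countable B -> countable (A `|` B).
Proof.
move=> cA cB; rewrite -bigcup2E; apply: bigcup_countable => // i _.
by rewrite /bigcup2; do 2 case: ifP => // _.
Qed.

Lemma card_le_setU_countable (T : Type) (A D : set T) :
  infinite_set A -> countable D -> A `|` D #<= A.
Proof.
elim/Ppointed: T => T in A D *.
  by rewrite [A]emptyE => /(_ (finite_set0 _)).
move=> /infiniteP/pcard_leP[f] cD; pose N := range f.
have NA : N `<=` A by move=> _ [n _ <-]; exact: funS.
have cN : countable N by exact: card_image_le.
have natN : [set: nat] #<= N by rewrite (card_le_eqr (card_image f)) card_lexx.
have /pcard_surjP[g g_surj] := card_le_trans (countable_setU cN cD) natN.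
pose h x := if x \in N then g x else x.
apply: card_le_trans (card_image_le h A); apply: subset_card_le => x ADx.
have [/g_surj[y Ny <-]|/not_orP[nNx nDx]] := pselect ((N `|` D) x).
  by exists y; [exact: NA|rewrite /h mem_set].
exists x; first by case: ADx.
by rewrite /h memNset.
Qed.

Lemma small_setU_countable (kappa T : Type) (A D : set T) :
  small kappa [set: nat] -> small kappa A -> countable D ->
  small kappa (A `|` D).
Proof.
have small_le (S T' : Type) (X : set S) (Y : set T') :
    X #<= Y -> small kappa Y -> small kappa X.
  move=> XY [Yk nkY]; split; first exact: card_le_trans Yk.
  by move=> kX; apply: nkY; exact: card_le_trans XY.
move=> smN smA cD; have [finA|infA] := pselect (finite_set A).
  by apply: small_le smN; exact: countable_setU (finite_set_countable finA) cD.
exact: small_le (card_le_setU_countable infA cD) smA.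
Qed.

Lemma finite_set_directed (T I : Type) (P : I -> set T) (i0 : I) (S0 : set T) :
  (forall i j, exists l, P i `|` P j `<=` P l) ->
  finite_set S0 -> (forall x, S0 x -> exists i, P i x) ->
  exists i, S0 `<=` P i.
Proof.
move=> dirP [n]; elim: n S0 => [|n IH] S0.
  by rewrite II0 card_eq0 => /eqP-> _; exists i0.
move=> /eq_cardSP[x S0x /IH{}IH] covS0.
have [y [/covS0//]|i sub_i] := IH; have [j Pjx] := covS0 _ S0x.
have [l sub_l] := dirP i j; exists l => y S0y; apply: sub_l.
have [->|yx] := pselect (y = x); first by right.
by left; apply: sub_i.
Qed.

(** * Renaming of variables *)

Definition copair (X V W : Type) (v : V -> X) (w : W -> X) (s : V + W) : X :=
  match s with inl i => v i | inr i => w i end.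

Lemma comp_copair (X Y V W : Type) (f : X -> Y) (v : V -> X) (w : W -> X) :
  f \o copair v w = copair (f \o v) (f \o w).
Proof. by apply: funext; case. Qed.

Section Renaming.
Variable L : language.

Lemma tren_comp (V W Z : Type) (h : V -> W) (g : W -> Z) (s : term L V) :
  tren g (tren h s) = tren (g \o h) s.
Proof.
by elim: s => [x|f args IH] //=; congr Tapp; apply: funext => i; exact: IH.
Qed.

Lemma fren_comp (V W Z : Type) (h : V -> W) (g : W -> Z) (phi : formula L V) :
  fren g (fren h phi) = fren (g \o h) phi.
Proof.
elim: phi W Z h g => {V} /=.
- by move=> V s1 s2 W Z h g; rewrite !tren_comp.
- by move=> V r args W Z h g; congr Frel; apply: funext => i; exact: tren_comp.
- by move=> V psi IH W Z h g; rewrite IH.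
- by move=> V psi1 IH1 psi2 IH2 W Z h g; rewrite IH1 IH2.
- move=> V psi IH W Z h g; rewrite IH; congr (Fex (fren _ _)).
  by apply: funext; case.
Qed.

Lemma teval_tren (N : structure L) (V W : Type) (h : V -> W) (v : W -> N)
  (s : term L V) : teval v (tren h s) = teval (v \o h) s.
Proof.
by elim: s => [x|f args IH] //=; congr fint; apply: funext => i; exact: IH.
Qed.

Lemma sat_fren (N : structure L) (V W : Type) (h : V -> W) (v : W -> N)
  (phi : formula L V) : sat (fren h phi) v = sat phi (v \o h).
Proof.
elim: phi W h v => {V} /=.
- by move=> V s1 s2 W h v; rewrite !teval_tren.
- by move=> V r args W h v; congr rint; apply: funext => i; exact: teval_tren.
- by move=> V psi IH W h v; rewrite IH.
- by move=> V psi1 IH1 psi2 IH2 W h v; rewrite IH1 IH2.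
- move=> V psi IH W h v; congr ex; apply: funext => c; rewrite IH.
  by congr sat; apply: funext; case.
Qed.

Lemma sat_Fexn (N : structure L) (n : nat) (V : Type)
    (phi : formula L (V + 'I_n)) (v : V -> N) :
  sat (Fexn phi) v <-> exists a : 'I_n -> N, sat phi (copair v a).
Proof.
elim: n V phi v => [|n IH] V phi v /=.
  rewrite sat_fren; split=> [|[a]] sat_phi;
    [exists (fun i : 'I_0 => False_rect N (notF (ltn_ord i)))|];
    by congr (sat phi _): sat_phi; apply: funext; case=> // -[].
split=> [[c /IH[a]]|[a sat_phi]].
  rewrite sat_fren => sat_phi.
  exists (fun i => if unlift ord0 i is Some i' then a i' else c).
  congr (sat phi _): sat_phi; apply: funext; case=> //= i.
  by case: (unlift ord0 i).
exists (a ord0); apply/IH; exists (a \o lift ord0); rewrite sat_fren.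
congr (sat phi _): sat_phi; apply: funext; case=> //= i.
by case: unliftP => [l ->|->].
Qed.

Definition Ftrue (V : Type) : formula L V := Fex (Feq (Tvar None) (Tvar None)).

Lemma sat_Ftrue (N : structure L) (V : Type) (v : V -> N) : sat (Ftrue V) v.
Proof. by have [u] := carrier_inhabited N; exists u. Qed.

Lemma finite_factor_sum (P : finType) (V W : Type) (c : P -> V + W) :
  exists (Q : finType) (q : P -> V + Q) (d : Q -> W),
    c = copair inl (inr \o d) \o q.
Proof.
have [[w0]|W0] := pselect (inhabited W).
  exists P, (fun p => if c p is inl v then inl v else inr p).
  exists (fun p => if c p is inr w then w else w0).
  by apply: funext => p /=; case E : (c p) => //=; rewrite E.
pose no_inr w : False := W0 (inhabits w).
exists void, (fun p => match c p with inl v => inl v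
                       | inr w => False_rect _ (no_inr w) end), (of_void W).
by apply: funext => p /=; case: (c p) => [//|w]; case: (no_inr w).
Qed.

Lemma tren_finite_support_family (I : finType) (V : Type) (s : I -> term L V) :
  (forall i, exists (P : finType) (c : P -> V) (s' : term L P),
     s i = tren c s') ->
  exists (P : finType) (c : P -> V) (s' : I -> term L P),
    s = fun i => tren c (s' i).
Proof.
move=> supp; have /choice[y def_s] i :
    exists y : {P : finType & (P -> V) * term L P}%type,
      s i = tren (projT2 y).1 (projT2 y).2.
  by have [P [c [s' ->]]] := supp i; exists (existT _ P (c, s')).
exists {i : I & projT1 (y i)}.
exists (fun p => (projT2 (y (tag p))).1 (tagged p)).
exists (fun i => tren (Tagged (fun i => projT1 (y i))) (projT2 (y i)).2).
by apply: funext => i; rewrite def_s tren_comp.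
Qed.

Lemma tren_finite_support (V : Type) (s : term L V) :
  exists (P : finType) (c : P -> V) (s' : term L P), s = tren c s'.
Proof.
elim: s => [x|f args IH]; first by exists unit, (fun=> x), (Tvar tt).
have [P [c [args' ->]]] := tren_finite_support_family IH.
by exists P, c, (Tapp args').
Qed.

Lemma fren_finite_support (V : Type) (phi : formula L V) :
  exists (P : finType) (c : P -> V) (psi : formula L P), phi = fren c psi.
Proof.
elim: phi => {V}.
- move=> V s1 s2; have [P1 [c1 [s1' ->]]] := tren_finite_support s1.
  have [P2 [c2 [s2' ->]]] := tren_finite_support s2.
  exists (P1 + P2)%type, (copair c1 c2), (Feq (tren inl s1') (tren inr s2')).
  by rewrite /= !tren_comp.
- move=> V r args; have [P [c [args' ->]]] :=
    tren_finite_support_family (fun i => tren_finite_support (args i)).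
  by exists P, c, (Frel args').
- by move=> V psi [P [c [psi' ->]]]; exists P, c, (Fnot psi').
- move=> V psi1 [P1 [c1 [psi1' ->]]] psi2 [P2 [c2 [psi2' ->]]].
  exists (P1 + P2)%type, (copair c1 c2).
  exists (Fand (fren inl psi1') (fren inr psi2')).
  by rewrite /= !fren_comp.
- move=> V psi [P [c [psi' ->]]].
  pose c_sum p : unit + V := if c p is Some v then inr v else inl tt.
  have [Q [q [d c_sumE]]] := finite_factor_sum c_sum.
  exists Q, d, (Fex (fren (copair (fun=> None) Some \o q) psi')).
  rewrite /= fren_comp; congr (Fex (fren _ _)); apply: funext => p /=.
  have := congr1 (fun h => h p) c_sumE; rewrite /c_sum /=.
  by case: (c p) => [v|]; case: (q p) => //= ? [->].
Qed.

Lemma fren_finite_params (V W : Type) (phi : formula L (V + W)) :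
  exists (m : nat) (psi : formula L (V + 'I_m)) (d : 'I_m -> W),
    phi = fren (copair inl (inr \o d)) psi.
Proof.
have [P [c [psi ->]]] := fren_finite_support phi.
have [Q [q [d ->]]] := finite_factor_sum c.
exists #|Q|, (fren (copair inl (inr \o enum_rank) \o q) psi), (d \o enum_val).
rewrite fren_comp; congr fren; apply: funext => p /=.
by case: (q p) => //= x; rewrite enum_rankK.
Qed.
End Renaming.

(** * Definable sets *)

Section Definable.
Variables (L : language) (U : structure L).
Implicit Types A B : set U.

Lemma holdsE n (phi : formula L ('I_n + U)) a :
  holds phi a = sat phi (copair a id).
Proof. by []. Qed.

Lemma holds_inst n m (psi : formula L ('I_n + 'I_m)) (d : 'I_m -> U) a :
  holds (inst psi d) a = sat psi (copair a d).
Proof.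
by rewrite /holds /inst sat_fren; congr sat; apply: funext; case.
Qed.

(* The set [A], seen as a type, supplies the parameters as extra variables. *)
Definition definable A (V : Type) (X : set (V -> U)) : Prop :=
  exists psi : formula L (V + A), forall v, X v <-> sat psi (copair v val).

Lemma overP A n (phi : formula L ('I_n + U)) :
  over A phi <->
  exists psi : formula L ('I_n + A), phi = fren (copair inl (inr \o val)) psi.
Proof.
split=> [[m [psi [d [Ad ->]]]]|[psi ->]].
  pose d' i : A := SigSub (mem_set (Ad i)).
  exists (fren (copair inl (inr \o d')) psi).
  by rewrite fren_comp comp_copair.
have [m [chi [d ->]]] := fren_finite_params psi.
exists m, chi, (val \o d); split=> [i|]; first exact: set_valP.
by rewrite fren_comp comp_copair.
Qed.

Lemma over_sub A B n (phi : formula L ('I_n + U)) :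
  A `<=` B -> over A phi -> over B phi.
Proof.
by move=> AB [m [psi [d [Ad ->]]]]; exists m, psi, d; split=> // i; exact: AB.
Qed.

Lemma over_true A n : over A (Ftrue L ('I_n + U)).
Proof. by apply/overP; exists (Ftrue L _). Qed.

Lemma over_not A n (phi : formula L ('I_n + U)) :
  over A phi -> over A (Fnot phi).
Proof. by move=> /overP[psi ->]; apply/overP; exists (Fnot psi). Qed.

Lemma over_and A n (phi psi : formula L ('I_n + U)) :
  over A phi -> over A psi -> over A (Fand phi psi).
Proof.
by move=> /overP[phi' ->] /overP[psi' ->]; apply/overP; exists (Fand phi' psi').
Qed.

Lemma over_inst_range n m (psi : formula L ('I_n + 'I_m)) (d : 'I_m -> U) :
  over (range d) (inst psi d).
Proof. by exists m, psi, d; split=> // i; exists i. Qed.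

Lemma over_setT n (phi : formula L ('I_n + U)) : over setT phi.
Proof.
by have [m [psi [d ->]]] := fren_finite_params phi; exists m, psi, d.
Qed.

Lemma exists_inst n (phi : formula L ('I_n + U)) :
  exists m (psi : formula L ('I_n + 'I_m)) (d : 'I_m -> U), phi = inst psi d.
Proof. exact: fren_finite_params. Qed.

Lemma definableP A n (X : set ('I_n -> U)) :
  definable A X <-> exists2 phi, over A phi & forall a, X a <-> holds phi a.
Proof.
split=> [[psi XE]|[phi /overP[psi ->] XE]].
  exists (fren (copair inl (inr \o val)) psi); first by apply/overP; exists psi.
  by move=> a; rewrite XE holdsE sat_fren comp_copair.
by exists psi => a; rewrite XE holdsE sat_fren comp_copair.
Qed.

Lemma definable_holds A n (phi : formula L ('I_n + U)) :
  over A phi -> definable A (holds phi).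
Proof. by move=> Aphi; apply/definableP; exists phi. Qed.

Section Closure.
Variable A : set U.

Lemma eq_definable V (X Y : set (V -> U)) :
  (forall v, X v <-> Y v) -> definable A X -> definable A Y.
Proof. by move=> XY [psi XE]; exists psi => v; rewrite -XY. Qed.

(* [h] may rename variables and replace some of them by parameters. *)
Lemma definable_subst V W (h : V -> W + A) (X : set (V -> U)) :
  definable A X -> definable A (fun w : W -> U => X (copair w val \o h)).
Proof.
move=> [psi XE]; exists (fren (copair h inr) psi) => w.
by rewrite XE sat_fren comp_copair.
Qed.

Lemma definable_rename V W (h : V -> W) (X : set (V -> U)) :
  definable A X -> definable A (fun w : W -> U => X (w \o h)).
Proof. exact: (@definable_subst _ _ (inl \o h)). Qed.

Lemma definable_param V W (d : W -> U) (X : set (V + W -> U)) :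
  (forall i, A (d i)) -> definable A X -> definable A (fun v => X (copair v d)).
Proof.
move=> Ad; pose d' i : A := SigSub (mem_set (Ad i)).
move=> /(@definable_subst _ _ (copair inl (inr \o d'))).
by apply: eq_definable => v; rewrite comp_copair.
Qed.

Lemma definable_sat V (phi : formula L V) : definable A (fun v => sat phi v).
Proof. by exists (fren inl phi) => v; rewrite sat_fren. Qed.

Lemma definable_cst V (Q : Prop) : definable A (fun _ : V -> U => Q).
Proof.
have [q|nq] := pselect Q; [exists (Ftrue L _)|exists (Fnot (Ftrue L _))] => v.
  by split=> // _; exact: sat_Ftrue.
by split=> // ntrue; case: ntrue; exact: sat_Ftrue.
Qed.

Lemma definable_not V (X : set (V -> U)) :
  definable A X -> definable A (fun v => ~ X v).
Proof. by move=> [psi XE]; exists (Fnot psi) => v /=; rewrite XE. Qed.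

Lemma definable_and V (X Y : set (V -> U)) :
  definable A X -> definable A Y -> definable A (fun v => X v /\ Y v).
Proof.
by move=> [psi XE] [chi YE]; exists (Fand psi chi) => v /=; rewrite XE YE.
Qed.

Lemma definable_imp V (X Y : set (V -> U)) :
  definable A X -> definable A Y -> definable A (fun v => X v -> Y v).
Proof.
move=> DX /definable_not DY.
apply: eq_definable (definable_not (definable_and DX DY)) => v.
by split=> [XY Xv|XY [/XY//]]; apply: contrapT => nYv; exact: XY.
Qed.

Lemma definable_iff V (X Y : set (V -> U)) :
  definable A X -> definable A Y -> definable A (fun v => X v <-> Y v).
Proof. by move=> DX DY; apply: definable_and; apply: definable_imp. Qed.

Lemma definable_exists V n (X : set (V + 'I_n -> U)) :
  definable A X -> definable A (fun v => exists a, X (copair v a)).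
Proof.
move=> [psi XE]; pose swap : (V + 'I_n) + A -> (V + A) + 'I_n :=
  copair (copair (inl \o inl) inr) (inl \o inr).
exists (Fexn (fren swap psi)) => v.
by rewrite sat_Fexn; split=> -[a Xa]; exists a; move: Xa;
  rewrite XE sat_fren /swap !comp_copair.
Qed.

Lemma definable_forall V n (X : set (V + 'I_n -> U)) :
  definable A X -> definable A (fun v => forall a, X (copair v a)).
Proof.
move=> /definable_not/definable_exists/definable_not; apply: eq_definable => v.
by split=> [/forallNP X_ a|X_ [a]]; [exact: contrapT|apply].
Qed.

Lemma definable_forall_fin V (I : finType) (X : I -> set (V -> U)) :
  (forall i, definable A (X i)) -> definable A (fun v => forall i, X i v).
Proof.
move=> DX.
suff D (s : seq I) : definable A (fun v => forall i, i \in s -> X i v).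
  apply: eq_definable (D (enum I)) => v.
  by split=> [Xv i|//]; apply: Xv; rewrite mem_enum.
elim: s => [|i s IH].
  by apply: eq_definable (definable_cst V True) => v.
apply: eq_definable (definable_and (DX i) IH) => v; split=> [[Xi Xs] l|Xv].
  by rewrite inE => /predU1P[->|/Xs].
by split=> [|l ls]; apply: Xv; rewrite inE ?eqxx // ls orbT.
Qed.
End Closure.

Lemma definable_sub A B V (X : set (V -> U)) :
  A `<=` B -> definable A X -> definable B X.
Proof.
move=> AB [psi XE].
pose inc (x : A) : B := SigSub (mem_set (AB _ (set_valP x))).
exists (fren (copair inl (inr \o inc)) psi) => v.
by rewrite XE sat_fren comp_copair.
Qed.

Lemma definable_param_sub A B V W (d : W -> U) (X : set (V + W -> U)) :
  A `<=` B -> (forall i, B (d i)) -> definable A X ->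
  definable B (fun v => X (copair v d)).
Proof.
by move=> AB Bd DX; apply: definable_param => //; exact: definable_sub DX.
Qed.

Definition same_type A (V : Type) (b c : V -> U) : Prop :=
  forall X, definable A X -> X b <-> X c.

Lemma same_type_sym A V (b c : V -> U) : same_type A b c -> same_type A c b.
Proof. by move=> bc X DX; rewrite bc. Qed.

Lemma equiv_overE A n (b c : 'I_n -> U) : equiv_over A b c <-> same_type A b c.
Proof.
split=> [bc X /definableP[phi Aphi XE]|bc phi Aphi]; first by rewrite !XE bc.
exact: bc (definable_holds Aphi).
Qed.

Lemma same_type_subst A V W (b c : W -> U) (h : V -> W + A) :
  same_type A b c -> same_type A (copair b val \o h) (copair c val \o h).
Proof. by move=> bc X /(definable_subst h) DX; exact: (bc _ DX). Qed.
End Definable.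

(** * Elementary embeddings and substructures *)

Section Elementary.
Variables (L : language) (N N' : structure L) (j : N -> N').
Hypothesis elem_j : elementary j.

Lemma elementary_forall (V W : Type) (phi : formula L (V + W)) (e : W -> N) :
  (forall v, sat phi (copair v e)) -> forall w, sat phi (copair w (j \o e)).
Proof.
move=> valid w.
have [m [psi [d phiE]]] := fren_finite_params (fren (copair inr inl) phi).
have satE (S : structure L) (v : V -> S) (f : W -> S) :
    sat phi (copair v f) = sat psi (copair f (v \o d)).
  transitivity (sat (fren (copair inr inl) phi) (copair f v)).
    by rewrite sat_fren comp_copair.
  by rewrite phiE sat_fren comp_copair.
(* [d] may list a variable several times; [rep] picks one of its indices. *)
pose idx x := [pick i | `[< d i = x >]].
pose rep i := odflt i (idx (d i)).
have idx_d i : idx (d i) = Some (rep i) /\ d (rep i) = d i.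
  rewrite /rep /idx; case: pickP => [l /asboolP//|/(_ i)].
  by rewrite asboolT.
have : ~ sat (Fexn (fren (copair inl (inr \o rep)) (Fnot psi))) e.
  move=> /sat_Fexn[u]; rewrite sat_fren comp_copair; apply.
  have [u0] := carrier_inhabited N.
  have := valid (fun x => oapp u u0 (idx x)); rewrite satE.
  by congr (sat psi (copair _ _)); apply: funext => i /=; rewrite (idx_d i).1.
rewrite elem_j satE; apply: contra_notP => nsat_psi.
apply/sat_Fexn; exists (w \o d); rewrite sat_fren comp_copair.
rewrite (_ : _ \o (inr \o rep) = w \o d) //.
by apply: funext => i /=; rewrite (idx_d i).2.
Qed.

Lemma elementary_imp (V W : Type) (phi psi : formula L (V + W)) (e : W -> N) :
  (forall v, sat phi (copair v e) -> sat psi (copair v e)) ->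
  forall w, sat phi (copair w (j \o e)) -> sat psi (copair w (j \o e)).
Proof.
move=> imp w sat_phi; apply: contrapT => nsat_psi.
have valid v : sat (Fnot (Fand phi (Fnot psi))) (copair v e).
  by move=> [/imp].
exact: (elementary_forall valid w).
Qed.
End Elementary.

Section ElementarySubstructure.
Variables (L : language) (U : structure L) (M : set U).
Hypothesis HM : elem_substructure M.

Lemma Tarski_Vaught n (X : set ('I_n -> U)) :
  definable M X -> (exists a, X a) -> exists a, (forall i, M (a i)) /\ X a.
Proof.
move=> [psi XE] [a Xa]; have [S [f [elem_f rangef]]] := HM.
have /choice[f' f'K] (x : M) : exists s, f s = val x.
  by have [s] : range f (val x) by [rewrite rangef; exact: set_valP]; exists s.
have valE : val = f \o f' by apply: funext => x; rewrite /= f'K.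
have : sat (Fexn (fren (copair inr inl) psi)) (f \o f').
  by apply/sat_Fexn; exists a; rewrite sat_fren comp_copair -valE -XE.
move=> /elem_f/sat_Fexn[c]; rewrite sat_fren comp_copair => /elem_f sat_c.
exists (f \o c); split=> [i|]; first by rewrite -rangef; exists (c i).
by apply/XE; rewrite valE -comp_copair.
Qed.

Lemma Tarski_Vaught_forall n (X : set ('I_n -> U)) :
  definable M X -> (forall a, (forall i, M (a i)) -> X a) -> forall a, X a.
Proof.
move=> DX XM a; apply: contrapT => nXa.
have [b [Mb]] := Tarski_Vaught (definable_not DX) (ex_intro _ a nXa).
by case; exact: XM.
Qed.

Lemma elem_substructure_nonempty : M !=set0.
Proof.
have [S [f [_ <-]]] := HM; have [s] := carrier_inhabited S.
by exists (f s), s.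
Qed.
End ElementarySubstructure.

(** * Complete types as ultrafilters of definable sets *)

Section Types.
Variables (L : language) (U : structure L) (k : nat).
Implicit Types (A B : set U) (p q S : set (formula L ('I_k + U))).
Implicit Types (X Y : set ('I_k -> U)).

Definition directed S : Prop := S !=set0 /\
  forall phi psi, S phi -> S psi ->
    exists2 chi, S chi & forall a, holds chi a -> holds phi a /\ holds psi a.

Lemma fin_sat_in_dominated A S D : directed D ->
  (forall psi, S psi ->
     exists2 phi, D phi & forall a, holds phi a -> holds psi a) ->
  (forall phi, D phi -> exists a, (forall i, A (a i)) /\ holds phi a) ->
  fin_sat_in A S.
Proof.
move=> [[phi0 Dphi0] dirD] domS satD S0 finS0 S0S.
pose implied (phi : {phi | D phi}) psi :=
  forall a, holds (sval phi) a -> holds psi a.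
have [||[phi Dphi] S0phi] :=
  finite_set_directed (P := implied) (exist _ _ Dphi0) _ finS0.
- move=> [phi Dphi] [psi Dpsi]; have [chi Dchi chiP] := dirD _ _ Dphi Dpsi.
  by exists (exist _ _ Dchi) => x [] impl a /chiP[? ?]; exact: impl.
- by move=> psi /S0S/domS[phi Dphi phi_psi]; exists (exist _ _ Dphi).
have [a [Aa sat_phi]] := satD _ Dphi.
by exists a; split=> // psi /S0phi; apply.
Qed.

Lemma fin_sat_in_directed A S : directed S ->
  (forall phi, S phi -> exists a, (forall i, A (a i)) /\ holds phi a) ->
  fin_sat_in A S.
Proof. by move=> dirS; apply: fin_sat_in_dominated => // psi; exists psi. Qed.

Lemma fin_sat_in_adjoin A S theta : directed S ->
  (forall phi, S phi ->
     exists a, (forall i, A (a i)) /\ holds (Fand theta phi) a) ->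
  fin_sat_in A (theta |` S).
Proof.
move=> [[phi0 Sphi0] dirS] satS.
apply: (fin_sat_in_dominated (D := [set Fand theta phi | phi in S])).
- split=> [|_ _ [phi Sphi <-] [psi Spsi <-]].
    by exists (Fand theta phi0), phi0.
  have [chi Schi chiP] := dirS _ _ Sphi Spsi.
  exists (Fand theta chi); first by exists chi.
  by move=> a [theta_a /chiP[]].
- move=> psi [->|Spsi].
    by exists (Fand theta phi0) => [|a []//]; exists phi0.
  by exists (Fand theta psi) => [|a []//]; exists psi.
- by move=> _ [phi Sphi <-]; exact: satS.
Qed.

Lemma directed_and S : S !=set0 ->
  (forall phi psi, S phi -> S psi -> S (Fand phi psi)) -> directed S.
Proof.
move=> S0 andS; split=> // phi psi Sphi Spsi.
by exists (Fand phi psi) => //; exact: andS.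
Qed.

Lemma decided_nonempty S : (forall phi, S phi \/ S (Fnot phi)) -> S !=set0.
Proof.
by move=> decS; have [?|?] := decS (Ftrue L _);
  [exists (Ftrue L _)|exists (Fnot (Ftrue L _))].
Qed.

Lemma complete_type_intro p :
  (forall phi psi, p phi -> p psi -> p (Fand phi psi)) ->
  (forall phi, p phi -> exists a, holds phi a) ->
  (forall phi, p phi \/ p (Fnot phi)) ->
  complete_type p.
Proof.
move=> andp satp decp; split=> //; apply: fin_sat_in_directed.
  by apply: directed_and => //; exact: decided_nonempty.
by move=> phi /satp[a sat_phi]; exists a.
Qed.

(* [X] need not be definable here. *)
Definition most p X : Prop := exists2 phi, p phi & forall a, holds phi a -> X a.

Lemma most_mono p X Y : (forall a, X a -> Y a) -> most p X -> most p Y.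
Proof. by move=> XY [phi pphi phiX]; exists phi => // a /phiX/XY. Qed.

Lemma eq_most p X Y : (forall a, X a <-> Y a) -> (most p X <-> most p Y).
Proof. by move=> XY; split; apply: most_mono => a /XY. Qed.

Lemma most_fin_sat A p X :
  fin_sat_in A p -> most p X -> exists a, (forall i, A (a i)) /\ X a.
Proof.
move=> fsp [phi pphi phiX].
have [||a [Aa sat_phi]] := fsp [set phi]; first exact: finite_set1.
  by move=> _ ->.
by exists a; split=> //; apply/phiX/sat_phi.
Qed.

Section Complete.
Variable p : set (formula L ('I_k + U)).
Hypothesis cp : complete_type p.

Lemma complete_type_sat3 phi psi chi : p phi -> p psi -> p chi ->
  exists a, [/\ holds phi a, holds psi a & holds chi a].
Proof.
move=> pphi ppsi pchi.
have [||a [_ sat_a]] := cp.1 [set phi; psi; chi]; first exact: finite_set3.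
  by move=> _ [[]|] ->.
by exists a; split; apply: sat_a; [left; left|left; right|right].
Qed.

Lemma most_holds phi : p phi <-> most p (holds phi).
Proof.
split=> [pphi|[psi ppsi psiphi]]; first by exists phi.
have [//|pnphi] := cp.2 phi.
by have [a [/psiphi]] := complete_type_sat3 ppsi pnphi pnphi.
Qed.

Lemma complete_type_and phi psi : p phi -> p psi -> p (Fand phi psi).
Proof.
move=> pphi ppsi; have [//|pn] := cp.2 (Fand phi psi).
by have [a [? ? []]] := complete_type_sat3 pphi ppsi pn.
Qed.

Lemma complete_type_directed : directed p.
Proof. exact: directed_and (decided_nonempty cp.2) complete_type_and. Qed.

Lemma most_and X Y : most p X -> most p Y -> most p (fun a => X a /\ Y a).
Proof.
move=> [phi pphi phiX] [psi ppsi psiY].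
exists (Fand phi psi); first exact: complete_type_and.
by move=> a [/phiX ? /psiY].
Qed.

Lemma most_exists X : most p X -> exists a, X a.
Proof. by move=> /(most_fin_sat cp.1)[a [_ Xa]]; exists a. Qed.

Lemma most_true : most p (fun=> True).
Proof. by have [phi pphi] := decided_nonempty cp.2; exists phi. Qed.

Lemma most_not X : definable setT X -> (most p (fun a => ~ X a) <-> ~ most p X).
Proof.
move=> /definableP[phi _ XE]; split=> [most_nX most_X|nmost_X].
  by have [a []] := most_exists (most_and most_X most_nX).
have [pphi|pnphi] := cp.2 phi; last by exists (Fnot phi) => // a; rewrite XE.
by case: nmost_X; exists phi => // a; rewrite XE.
Qed.

Lemma complete_type_eq q : complete_type q -> p `<=` q -> p = q.
Proof.
move=> cq pq; apply/seteqP; split=> // phi qphi.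
have [//|/pq qnphi] := cp.2 phi.
have [||a [_ sat_a]] := cq.1 [set phi; Fnot phi]; first exact: finite_set2.
  by move=> _ [] ->.
by case: (sat_a (Fnot phi)); [right|apply: sat_a; left].
Qed.

Definition realizes_over A b : Prop :=
  forall X, definable A X -> most p X -> X b.

Lemma realizes_overE A b X :
  realizes_over A b -> definable A X -> (X b <-> most p X).
Proof.
move=> rb DX; split=> [Xb|]; last exact: rb.
apply: contrapT => /most_not most_nX; apply: (rb _ (definable_not DX)) => //.
by apply: most_nX; exact: definable_sub DX.
Qed.

Lemma realizes_restrE A b : realizes b (restr A p) <-> realizes_over A b.
Proof.
split=> [rb X /definableP[phi Aphi XE] mX|rb phi [pphi Aphi]].
  apply/XE/rb; split=> //; apply/most_holds.
  by apply: most_mono mX => a; rewrite XE.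
exact: rb (definable_holds Aphi) (iffLR (most_holds phi) pphi).
Qed.

Lemma realizes_over_sub A B b :
  A `<=` B -> realizes_over B b -> realizes_over A b.
Proof. by move=> AB rb X DX; apply: rb; exact: definable_sub DX. Qed.

Lemma exists_realizes_over (sm : set (set U)) A :
  saturated sm -> sm A -> exists b, realizes_over A b.
Proof.
move=> satU smA.
have [|S0 finS0 S0p|b /realizes_restrE rb] := satU _ smA _ (restr A p).
- by move=> phi [].
- by apply: cp.1 => // phi /S0p[].
- by exists b.
Qed.
End Complete.

Lemma same_type_realizes_over A p b c : complete_type p ->
  realizes_over p A b -> realizes_over p A c -> same_type A b c.
Proof.
move=> cp rb rc X DX.
by rewrite (realizes_overE cp rb DX) (realizes_overE cp rc DX).
Qed.

Lemma definable_relation_inst A (V : Type) (R : set ('I_k + V -> U)) :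
  definable A R -> exists m (phi : formula L ('I_k + 'I_m)) (d : 'I_m -> V + A),
    forall v a, R (copair a v) <-> holds (inst phi (copair v val \o d)) a.
Proof.
move=> [psi RE].
pose reassoc : 'I_k + V + A -> 'I_k + (V + A) :=
  copair (copair inl (inr \o inl)) (inr \o inr).
have [m [phi [d phiE]]] := fren_finite_params (fren reassoc psi).
exists m, phi, d => v a; rewrite RE holds_inst.
transitivity (sat (fren reassoc psi) (copair a (copair v val))).
  by rewrite sat_fren /reassoc !comp_copair.
by rewrite phiE sat_fren comp_copair.
Qed.

Lemma definable_most A p (V : Type) (R : set ('I_k + V -> U)) :
  complete_type p -> definable_over A p -> definable A R ->
  definable A (fun v => most p (fun a => R (copair a v))).
Proof.
move=> cp dp /definable_relation_inst[m [phi [d RE]]].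
have [delta [Adelta deltaP]] := dp _ phi.
apply: eq_definable (definable_subst d (definable_holds Adelta)) => v.
by rewrite -deltaP (most_holds cp) (eq_most _ (RE v)).
Qed.

Lemma most_same_type A p (V : Type) (R : set ('I_k + V -> U)) b c :
  complete_type p -> invariant A p -> definable A R -> same_type A b c ->
  most p (fun a => R (copair a b)) -> most p (fun a => R (copair a c)).
Proof.
move=> cp ip /definable_relation_inst[m [phi [d RE]]] bc.
rewrite (eq_most _ (RE b)) (eq_most _ (RE c)) -!most_holds //.
by apply: iffLR; apply: ip; apply/equiv_overE; exact: same_type_subst.
Qed.

Lemma same_type_copair_realizes A p (V : Type) (d d' : V -> U) b b' :
  complete_type p -> invariant A p -> same_type A d d' ->
  realizes_over p (A `|` range d) b -> realizes_over p (A `|` range d') b' ->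
  same_type A (copair b d) (copair b' d').
Proof.
move=> cp ip dd' rb rb' X DX.
have Dfibre (e : V -> U) :
    definable (A `|` range e) (fun a => X (copair a e)).
  by apply: (definable_param_sub _ _ DX) => [x|i]; [left|right; exists i].
rewrite (realizes_overE cp rb (Dfibre d)) (realizes_overE cp rb' (Dfibre d')).
split; first exact: (most_same_type cp ip DX dd').
exact: (most_same_type cp ip DX (same_type_sym dd')).
Qed.

Lemma invariant_sub A B p : A `<=` B -> invariant A p -> invariant B p.
Proof.
move=> AB ip n phi b c bc; apply: ip => psi Apsi.
by apply: bc; exact: over_sub Apsi.
Qed.

Lemma definable_over_invariant A p : definable_over A p -> invariant A p.
Proof.
move=> dp n phi b c bc; have [psi [Apsi psiP]] := dp _ phi.
by rewrite !psiP; exact: bc.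
Qed.

Lemma fin_sat_in_invariant A p :
  complete_type p -> fin_sat_in A p -> invariant A p.
Proof.
move=> cp fsp n phi b c bc.
suff transfer (d e : 'I_n -> U) :
    same_type A d e -> p (inst phi d) -> p (inst phi e).
  by split; apply: transfer; [|apply: same_type_sym]; exact/equiv_overE.
move=> {b c bc} de pd; have [//|pne] := cp.2 (inst phi e).
have /(most_fin_sat fsp)[a [Aa []]] :=
  most_and cp (iffLR (most_holds cp _) pd) (iffLR (most_holds cp _) pne).
rewrite (_ : Fnot (inst phi e) = inst (Fnot phi) e) // !holds_inst => sat_d [].
have Dphi : definable A (fun v : 'I_n -> U => sat phi (copair a v)).
  have := definable_param Aa (definable_sat A (fren (copair inr inl) phi)).
  by apply: eq_definable => v; rewrite sat_fren comp_copair.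
exact: iffLR (de _ Dphi) sat_d.
Qed.

Lemma definable_types_eq M p q : elem_substructure M ->
  complete_type p -> complete_type q ->
  definable_over M p -> definable_over M q ->
  (forall X, definable M X -> most p X -> most q X) -> p = q.
Proof.
move=> HM cp cq dp dq pq; apply: complete_type_eq => // phi.
have [n [psi [d ->]]] := exists_inst phi; have Dpsi := definable_sat M psi.
have instE r b :
    most r (fun a => sat psi (copair a b)) <-> most r (holds (inst psi b)).
  by apply: eq_most => a; rewrite holds_inst.
rewrite !most_holds // -!instE; move: d.
have Dpq :=
  definable_imp (definable_most cp dp Dpsi) (definable_most cq dq Dpsi).
apply: (Tarski_Vaught_forall HM Dpq) => b Mb.
by apply: pq; exact: definable_param.
Qed.
End Types.

(** * The group and its points *)

Section GroupPoints.
Variables (L : language) (U : structure L) (k : nat) (G : definable_group U k).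
Implicit Types (A : set U) (X : set ('I_k -> U)).
Local Open Scope group_scope.

Record gpoint : Type :=
  GPoint { gtuple :> 'I_k -> U; gtuple_inG : inG G gtuple }.

Lemma gtuple_inj : injective gtuple.
Proof.
move=> [a Ga] [b Gb] /= ab; case: b / ab Gb => Gb.
by rewrite (Prop_irrelevance Gb Ga).
Qed.

HB.instance Definition _ := Choice.copy gpoint {classic gpoint}.

Fact gpoint_mul_sig (g h : gpoint) :
  {gh : gpoint | forall c, mulG G g h c <-> c = gh}.
Proof.
apply: cid; have [c [Gc cP]] := gmul_fun (gtuple_inG g) (gtuple_inG h).
by exists (GPoint Gc).
Qed.

Definition gpoint_mul g h : gpoint := sval (gpoint_mul_sig g h).

Fact gpoint_mulP (g h : gpoint) c : mulG G g h c <-> c = gpoint_mul g h.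
Proof. exact: (svalP (gpoint_mul_sig g h)). Qed.

Fact gpoint_one_sig : {e : gpoint |
  [/\ left_id e gpoint_mul, right_id e gpoint_mul
    & forall g, exists h, gpoint_mul h g = e /\ gpoint_mul g h = e]}.
Proof.
apply: cid; have [e [Ge eP]] := gmul_id_inv G.
exists (GPoint Ge).
split=> g; have [eg ge [g' [Gg' gg' g'g]]] := eP _ (gtuple_inG g).
- by apply/esym/gtuple_inj/gpoint_mulP.
- by apply/esym/gtuple_inj/gpoint_mulP.
- by exists (GPoint Gg'); split; apply/esym/gtuple_inj/gpoint_mulP.
Qed.

Definition gpoint_one : gpoint := sval gpoint_one_sig.

Fact gpoint_inv_sig : {iota : gpoint -> gpoint |
  left_inverse gpoint_one iota gpoint_mul /\
  right_inverse gpoint_one iota gpoint_mul}.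
Proof.
have [_ _ /choice[iota iotaP]] := svalP gpoint_one_sig.
by exists iota; split=> g; case: (iotaP g).
Qed.

Fact gpoint_mulA : associative gpoint_mul.
Proof.
move=> a b c; apply/esym/gtuple_inj.
apply: (gmul_assoc (gtuple_inG a) (gtuple_inG b) (gtuple_inG c));
  by apply/gpoint_mulP; reflexivity.
Qed.

Fact gpoint_mul1g : left_id gpoint_one gpoint_mul.
Proof. by case: (svalP gpoint_one_sig). Qed.

Fact gpoint_mulg1 : right_id gpoint_one gpoint_mul.
Proof. by case: (svalP gpoint_one_sig). Qed.

HB.instance Definition _ := isGroup.Build gpoint gpoint_mulA gpoint_mul1g
  gpoint_mulg1 (svalP gpoint_inv_sig).1 (svalP gpoint_inv_sig).2.

Lemma mulGE (g h : gpoint) c : mulG G g h c <-> c = (g * h).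
Proof. exact: gpoint_mulP. Qed.

Lemma mulG_idempotent (e : gpoint) : mulG G e e e <-> e = 1.
Proof.
rewrite mulGE; split=> [/gtuple_inj ee|->]; last by rewrite mulg1.
by apply: (mulgI e); rewrite -ee mulg1.
Qed.

(* The condition [X (a . b)], in a form that is definable for all tuples [a]
   and [b]; outside of [G] it is junk. *)
Definition mul_in X (a b : 'I_k -> U) : Prop := exists2 c, mulG G a b c & X c.

Lemma mul_inE X (g h : gpoint) : mul_in X g h <-> X (g * h).
Proof.
by split=> [[c /mulGE->]//|Xgh]; exists (g * h) => //; apply/mulGE.
Qed.

(* The condition [X (a^-1)], with the same proviso. *)
Definition inv_in X (a : 'I_k -> U) : Prop :=
  exists z e, [/\ inG G z, inG G e, mulG G e e e, mulG G a z e & X z].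

Lemma inv_inE X (g : gpoint) : inv_in X g <-> X g^-1.
Proof.
split=> [[z [e [Gz Ge ee gz Xz]]]|Xg].
  have e1 : GPoint Ge = 1 by apply/mulG_idempotent.
  have gz1 : g * GPoint Gz = 1 by rewrite -e1; apply/esym/gtuple_inj/mulGE.
  by rewrite (mulg1_eq gz1).
exists g^-1, (1 : gpoint); split=> //; try exact: gtuple_inG.
  exact/mulG_idempotent.
by apply/mulGE; rewrite mulgV.
Qed.

Lemma definable_mulG A V (x y z : 'I_k -> V) :
  definable A (fun v : V -> U => mulG G (v \o x) (v \o y) (v \o z)).
Proof.
have := definable_rename (copair (copair x y) z) (definable_sat A (gmul G)).
apply: eq_definable => v; rewrite !comp_copair //.
Qed.

Lemma definable_mul_in_rel A (V W : Type) (X : set ('I_k + V -> U))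
    (x y : 'I_k -> W) (z : V -> W) :
  definable A X -> definable A (fun w : W -> U =>
    mul_in (fun c => X (copair c (w \o z))) (w \o x) (w \o y)).
Proof.
move=> /(definable_rename (copair inr (inl \o z))) DX.
have Dmul := definable_mulG A (inl \o x) (inl \o y) (inr : 'I_k -> W + 'I_k).
apply: eq_definable (definable_exists (definable_and Dmul DX)) => w.
split=> -[c]; last by exists c; rewrite comp_copair.
by rewrite comp_copair => -[]; exists c.
Qed.

Lemma definable_mul_in A (W : Type) X (x y : 'I_k -> W) :
  definable A X -> definable A (fun w : W -> U => mul_in X (w \o x) (w \o y)).
Proof.
move=> /(definable_rename (inl : _ -> 'I_k + void)).
exact: (definable_mul_in_rel _ _ (of_void _)).
Qed.

Lemma definable_inv_in_rel A (V W : Type) (X : set ('I_k + V -> U))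
    (x : 'I_k -> W) (y : V -> W) :
  definable A X -> definable A (fun w : W -> U =>
    inv_in (fun c => X (copair c (w \o y))) (w \o x)).
Proof.
pose z : 'I_k -> W + 'I_k + 'I_k := inl \o inr.
pose e : 'I_k -> W + 'I_k + 'I_k := inr.
move=> /(definable_rename (copair z (inl \o inl \o y))) DX.
have DG s := definable_rename s (definable_sat A (gdom G)).
have Dee := definable_mulG A e e e.
have Dxz := definable_mulG A (inl \o inl \o x) z e.
have D := definable_and (definable_and (DG _ z) (DG _ e))
  (definable_and Dee (definable_and Dxz DX)).
apply: eq_definable (definable_exists (definable_exists D)) => w.
split=> -[a [b]].
  by rewrite comp_copair => -[[? ?] [? []]]; exists a, b.
by case=> *; exists a, b; rewrite comp_copair.
Qed.

Lemma definable_inv_in A (W : Type) X (x : 'I_k -> W) :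
  definable A X -> definable A (fun w : W -> U => inv_in X (w \o x)).
Proof.
move=> /(definable_rename (inl : _ -> 'I_k + void)).
exact: (definable_inv_in_rel _ (of_void _)).
Qed.

Lemma holds_subst_rmul phi b a :
  holds (subst_rmul G phi b) a <-> mul_in (holds phi) a b.
Proof.
have -> : subst_rmul G phi b = Fexn (Fand
    (fren (copair (copair (inl \o inl) (inl \o inr \o b)) inr) (gmul G))
    (fren (copair inr (inl \o inr)) phi)) by [].
rewrite holdsE sat_Fexn.
split=> -[c]; last by exists c; rewrite /= !sat_fren !comp_copair.
by rewrite /= !sat_fren !comp_copair => -[]; exists c.
Qed.

Lemma holds_subst_inv phi a :
  holds (subst_inv G phi) a <-> inv_in (holds phi) a.
Proof.
pose z : 'I_k -> 'I_k + U + 'I_k + 'I_k := inl \o inr.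
pose e : 'I_k -> 'I_k + U + 'I_k + 'I_k := inr.
have -> : subst_inv G phi = Fexn (Fexn (Fand
    (Fand (fren z (gdom G)) (fren e (gdom G)))
    (Fand (Fand (fren (copair (copair e e) e) (gmul G))
                (fren (copair (copair (inl \o inl \o inl) z) e) (gmul G)))
          (fren (copair z (inl \o inl \o inr)) phi)))) by [].
rewrite holdsE sat_Fexn.
split=> [[b /sat_Fexn[c]]|[b [c [Gb Gc cc abc phib]]]].
  by rewrite /= !sat_fren !comp_copair => -[[? ?] [[? ?] ?]]; exists b, c.
by exists b; apply/sat_Fexn; exists c; rewrite /= !sat_fren !comp_copair.
Qed.

Definition mostG (p : set (formula L ('I_k + U))) (Y : set gpoint) : Prop :=
  most p [set a | forall g : gpoint, g = a :> ('I_k -> U) -> Y g].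

Lemma mostG_mono p (Y Z : set gpoint) :
  (forall g, Y g -> Z g) -> mostG p Y -> mostG p Z.
Proof. by move=> YZ; apply: most_mono => a Ya g /Ya/YZ. Qed.

Lemma eq_mostG p (Y Z : set gpoint) :
  (forall g, Y g <-> Z g) -> (mostG p Y <-> mostG p Z).
Proof. by move=> YZ; split; apply: mostG_mono => g /YZ. Qed.

Definition definableG A (Y : set gpoint) : Prop :=
  exists2 X, definable A X & forall g : gpoint, Y g <-> X g.

Lemma definableG_sub A B Y : A `<=` B -> definableG A Y -> definableG B Y.
Proof. by move=> AB [X DX YX]; exists X => //; exact: definable_sub DX. Qed.

Lemma definableG_gtuple A X : definable A X -> definableG A (fun g => X g).
Proof. by move=> DX; exists X. Qed.

Lemma definableG_holds A phi :
  over A phi -> definableG A (fun g => holds phi g).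
Proof. by move=> Aphi; apply: definableG_gtuple; exact: definable_holds. Qed.

Lemma definableG_mulr A Y (h : gpoint) : (forall i, A (h i)) ->
  definableG A Y -> definableG A (fun g => Y (g * h)).
Proof.
move=> Ah [X DX YX]; exists (fun a => mul_in X a h).
  exact: definable_param (definable_mul_in inl inr DX).
by move=> g; rewrite mul_inE YX.
Qed.

Lemma definableG_mull A Y (h : gpoint) : (forall i, A (h i)) ->
  definableG A Y -> definableG A (fun g => Y (h * g)).
Proof.
move=> Ah [X DX YX]; exists (fun a => mul_in X h a).
  exact: definable_param (definable_mul_in inr inl DX).
by move=> g; rewrite mul_inE YX.
Qed.

Lemma definableG_inv A Y : definableG A Y -> definableG A (fun g => Y g^-1).
Proof.
move=> [X DX YX]; exists (inv_in X); first exact: (definable_inv_in id DX).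
by move=> g; rewrite inv_inE YX.
Qed.

Lemma S_G_intro p : complete_type p -> most p (inG G) -> S_G G p.
Proof.
move=> cp pG; split=> //; apply/most_holds => //.
by apply: most_mono pG => a; rewrite holdsE sat_fren.
Qed.

Section TypesOnG.
Variable p : set (formula L ('I_k + U)).
Hypothesis Sp : S_G G p.
Let cp : complete_type p := Sp.1.

Lemma most_inG : most p (inG G).
Proof.
by exists (fren inl (gdom G)); [exact: Sp.2|move=> a; rewrite holdsE sat_fren].
Qed.

Lemma mostG_gtuple X : mostG p (fun g => X g) <-> most p X.
Proof.
split=> pX; last by apply: most_mono pX => a Xa g ->.
apply: most_mono (most_and cp most_inG pX) => a [Ga Xa].
exact: (Xa (GPoint Ga)).
Qed.

Lemma mostG_holds phi : p phi <-> mostG p (fun g => holds phi g).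
Proof. by rewrite mostG_gtuple -most_holds. Qed.

Lemma mostG_inG : mostG p (fun g => inG G g).
Proof. by apply/mostG_gtuple; exact: most_inG. Qed.

Lemma mostG_and Y Z : mostG p Y -> mostG p Z -> mostG p (fun g => Y g /\ Z g).
Proof.
move=> pY pZ; apply: most_mono (most_and cp pY pZ) => a [Ya Za] g ga.
by split; [exact: Ya|exact: Za].
Qed.

Lemma mostG_not A Y : definableG A Y ->
  (mostG p (fun g => ~ Y g) <-> ~ mostG p Y).
Proof.
move=> [X /(definable_sub (@subsetT _ A)) DX YX].
have -> : Y = (fun g => X g) by apply/predeqP.
by rewrite mostG_gtuple -most_not // -mostG_gtuple.
Qed.

Lemma mostG_fin_sat A Y : fin_sat_in A p -> mostG p Y ->
  exists2 g : gpoint, (forall i, A (g i)) & Y g.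
Proof.
move=> fsp /(most_and cp most_inG)/(most_fin_sat fsp)[a [Aa [Ga Ya]]].
by exists (GPoint Ga); [|exact: Ya].
Qed.

Lemma realizes_over_inG A b : realizes_over p A b -> inG G b.
Proof. by move=> rb; apply: rb most_inG; exact: definable_sat. Qed.

Lemma mostG_realizes_over A (g : gpoint) Y :
  realizes_over p A g -> definableG A Y -> (Y g <-> mostG p Y).
Proof.
move=> rg [X DX YX]; rewrite (eq_mostG _ YX) mostG_gtuple YX.
exact: (realizes_overE cp rg DX).
Qed.

Lemma mostG_same_type A (W : Type) (R : set ('I_k + W -> U)) (x : 'I_k -> W)
    (w w' : W -> U) (g g' : gpoint) :
  invariant A p -> definable A R -> same_type A w w' ->
  w \o x = g -> w' \o x = g' ->
  mostG p (fun h => R (copair (h * g)%g w)) ->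
  mostG p (fun h => R (copair (h * g')%g w')).
Proof.
move=> ip DR ww' wg w'g'.
pose mulR (v : 'I_k + W -> U) : Prop :=
  mul_in (fun c => R (copair c (v \o inr))) (v \o inl) (v \o (inr \o x)).
have mulRE v (h : gpoint) : v \o x = h ->
    mostG p (fun f => R (copair (f * h)%g v)) <->
    most p (fun a => mulR (copair a v)).
  move=> vh; rewrite -mostG_gtuple; apply: eq_mostG => f.
  by rewrite -(mul_inE (fun c => R (copair c v))) -vh.
rewrite (mulRE _ _ wg) (mulRE _ _ w'g').
apply: (most_same_type cp ip _ ww').
exact: definable_mul_in_rel.
Qed.

Lemma rtranslateE (c : gpoint) phi :
  rtranslate G p c phi <-> mostG p (fun g => holds phi (g * c)).
Proof.
rewrite /rtranslate /= most_holds // (eq_most _ (holds_subst_rmul _ _)).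
by rewrite -mostG_gtuple; apply: eq_mostG => g; exact: mul_inE.
Qed.

Lemma type_invE phi :
  type_inv G p phi <-> mostG p (fun g => holds phi (g^-1)%g).
Proof.
rewrite /type_inv /= most_holds // (eq_most _ (holds_subst_inv _)).
by rewrite -mostG_gtuple; apply: eq_mostG => g; exact: inv_inE.
Qed.
End TypesOnG.

Section ImageType.
Variables (p q : set (formula L ('I_k + U))) (f : gpoint -> gpoint).
Hypothesis Sp : S_G G p.
Hypothesis definable_f :
  forall Y, definableG setT Y -> definableG setT (fun g => Y (f g)).
Hypothesis qE : forall phi, q phi <-> mostG p (fun g => holds phi (f g)).

Let complete_q : complete_type q.
Proof.
apply: complete_type_intro => [phi psi|phi|phi].
- by move=> /qE pphi /qE ppsi; exact/qE/(mostG_and Sp pphi ppsi).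
- by move=> /qE/(mostG_fin_sat Sp Sp.1.1)[g _ phig]; exists (f g).
- have Dphi := definable_f (definableG_holds (over_setT phi)).
  by rewrite !qE (mostG_not Sp Dphi); exact: EM.
Qed.

Let most_q X :
  definable setT X -> (most q X <-> mostG p (fun g => X (f g))).
Proof.
move=> /definableP[phi _ XE]; rewrite (eq_most _ XE) -most_holds // qE.
by apply: eq_mostG => g; rewrite XE.
Qed.

Lemma S_G_image : S_G G q.
Proof.
apply: S_G_intro complete_q _; apply/most_q; first exact: definable_sat.
by apply: mostG_mono (mostG_inG Sp) => g _; exact: gtuple_inG.
Qed.

Lemma mostG_image Y :
  definableG setT Y -> (mostG q Y <-> mostG p (fun g => Y (f g))).
Proof.
move=> [X DX YX]; rewrite (eq_mostG _ YX) (mostG_gtuple S_G_image) most_q //.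
by apply: eq_mostG => g; rewrite YX.
Qed.
End ImageType.
End GroupPoints.
Arguments gtuple_inj {L U k G}.

(** * Groups inside a semigroup *)

Section EllisSubgroups.
Variables (X : Type) (op : X -> X -> X) (S H : set X) (u : X).
Hypotheses (HS : H `<=` S) (Hu : H u).
Hypothesis opuH : forall x, H x -> op u x = x.
Hypothesis opHu : forall x, H x -> op x u = x.
Hypothesis opVH : forall x, H x -> exists2 y, H y & op y x = u.

Lemma right_ideal_ellis_subgroup :
  (forall x y, S x -> S y -> S (op x y)) ->
  (forall x y z, S x -> S y -> S z -> op x (op y z) = op (op x y) z) ->
  (forall x y, H x -> S y -> H (op x y)) ->
  ellis_subgroup op S H.
Proof.
move=> opS opA HopS; have Su := HS Hu.
exists [set op s u | s in S], u; split.
- split=> [|J [JS [z Jz] SopJ] sub].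
    split=> [_ [s Ss <-]||s _ Ss [s' Ss' <-]]; first exact: opS.
      by exists (op u u), u.
    by exists (op s s'); [exact: opS|rewrite opA].
  apply/seteqP; split=> // _ [s Ss <-]; apply: (SopJ) => //.
  have [y Hy <-] := opVH (HopS _ _ Hu (JS _ Jz)).
  by apply: (SopJ); [exact: HS|exact: SopJ].
- by exists u => //; exact: opuH.
- exact: opuH.
- apply/seteqP; split=> [x Hx|_ [_ [s Ss <-] <-]].
    exists (op x u); last by rewrite opHu // opuH.
    by exists x => //; exact: HS.
  by apply: HopS => //; exact: opS.
Qed.

Lemma left_ideal_ellis_subgroup :
  (forall x y, S x -> H y -> H (op x y)) -> ellis_subgroup op S H.
Proof.
move=> SopH; exists H, u; split=> //.
- split=> [|J [JS [z Jz] SopJ] sub]; first by split=> //; exists u.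
  apply/seteqP; split=> // x Hx; have [y Hy yz] := opVH (sub _ Jz).
  rewrite -(opHu Hx) -yz; apply: (SopJ); first exact: HS.
  by apply: SopJ => //; exact: HS.
- exact: opuH.
- apply/seteqP; split=> [x Hx|_ [x Hx <-]]; last by rewrite opuH.
  by exists x => //; exact: opuH.
Qed.
End EllisSubgroups.

(** * Elementary extensions of pairs *)

Local Notation sat_pair P := (@sat (lang_pred _) (pair_structure P) _).

Section PairFormulas.
Variable L : language.

Fixpoint tlift (V : Type) (s : term L V) : term (lang_pred L) V :=
  match s with
  | Tvar v => Tvar v
  | Tapp f args => @Tapp (lang_pred L) V f (fun i => tlift (args i))
  end.

Fixpoint flift (V : Type) (phi : formula L V) : formula (lang_pred L) V :=
  match phi with
  | Feq s1 s2 => Feq (tlift s1) (tlift s2)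
  | Frel r args => @Frel (lang_pred L) _ (Some r) (fun i => tlift (args i))
  | Fnot psi => Fnot (flift psi)
  | Fand psi1 psi2 => Fand (flift psi1) (flift psi2)
  | Fex psi => Fex (flift psi)
  end.

Definition all_pred (V : Type) (s : seq V) : formula (lang_pred L) V :=
  foldr (fun x => Fand (@Frel (lang_pred L) V None (fun=> Tvar x)))
        (Ftrue (lang_pred L) V) s.

Definition Fexn_pred (n : nat) (V : Type)
    (phi : formula (lang_pred L) (V + 'I_n)) : formula (lang_pred L) V :=
  Fexn (Fand (fren inr (all_pred (enum 'I_n))) phi).

Variables (N : structure L) (P : set N).

Lemma teval_tlift (V : Type) (v : V -> N) (s : term L V) :
  @teval _ (pair_structure P) V v (tlift s) = teval v s.
Proof.
by elim: s => [//|f args IH] /=; congr fint; apply: funext => i; exact: IH.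
Qed.

Lemma sat_flift (V : Type) (v : V -> N) (phi : formula L V) :
  sat_pair P (flift phi) v = sat phi v.
Proof.
elim: phi v => {V} /=.
- by move=> V s1 s2 v; rewrite !teval_tlift.
- by move=> V r args v; congr rint; apply: funext => i; exact: teval_tlift.
- by move=> V psi IH v; rewrite IH.
- by move=> V psi1 IH1 psi2 IH2 v; rewrite IH1 IH2.
- by move=> V psi IH v; congr ex; apply: funext => c; exact: IH.
Qed.

Lemma sat_all_pred (V : eqType) (s : seq V) (v : V -> N) :
  sat_pair P (all_pred s) v <-> {in s, forall x, P (v x)}.
Proof.
elim: s => [|x s IH]; first by split=> // _; exact: sat_Ftrue.
rewrite /= IH; split=> [[Px Ps] y|Pxs].
  by rewrite inE => /predU1P[->|/Ps].
by split=> [|y ys]; apply: Pxs; rewrite inE ?eqxx // ys orbT.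
Qed.

Lemma sat_Fexn_pred (n : nat) (V : Type)
    (phi : formula (lang_pred L) (V + 'I_n)) (v : V -> N) :
  sat_pair P (Fexn_pred phi) v <->
  exists a, (forall i, P (a i)) /\ sat_pair P phi (copair v a).
Proof.
have bodyE a :
    sat_pair P (Fand (fren inr (all_pred (enum 'I_n))) phi) (copair v a) <->
    (forall i, P (a i)) /\ sat_pair P phi (copair v a).
  rewrite /= sat_fren sat_all_pred; split=> -[Pa phia]; split=> // i.
  by apply: Pa; rewrite mem_enum.
by rewrite sat_Fexn; split=> -[a /bodyE]; exists a.
Qed.
End PairFormulas.

Section PairExtension.
Variables (L : language) (U N' : structure L) (M : set U) (N : set N').
Variable j : U -> N'.
Hypothesis elem_pair :
  @elementary (lang_pred L) (pair_structure M) (pair_structure N) j.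

Lemma pair_elementary : elementary j.
Proof.
by move=> V phi v; have := elem_pair (flift phi) v; rewrite !sat_flift.
Qed.

Lemma pair_image_sub : j @` M `<=` N.
Proof.
move=> _ [u Mu <-]; have := elem_pair (all_pred L [:: tt]) (fun=> u).
by rewrite !sat_all_pred => -[NM _]; apply: (NM _ tt).
Qed.

Lemma pair_transfer (m : nat) (W : Type)
    (phi psi : formula (lang_pred L) (W + 'I_m)) (e : W -> U) :
  (forall n : 'I_m -> U, (forall i, M (n i)) ->
     sat_pair M phi (copair e n) -> sat_pair M psi (copair e n)) ->
  forall n : 'I_m -> N', (forall i, N (n i)) ->
     sat_pair N phi (copair (j \o e) n) -> sat_pair N psi (copair (j \o e) n).
Proof.
move=> imp n Nn sat_phi; apply: contrapT => nsat_psi.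
have : sat_pair N (Fexn_pred (Fand phi (Fnot psi))) (j \o e).
  by apply/sat_Fexn_pred; exists n.
by move=> /elem_pair/sat_Fexn_pred[a [Ma [phi_a]]]; apply; exact: imp.
Qed.

Let sat_swap (S : structure L) (P : set S) (V W : Type)
    (phi : formula L (V + W)) (v : V -> S) (w : W -> S) :
  sat_pair P (flift (fren (copair inr inl) phi)) (copair w v) =
  sat phi (copair v w).
Proof. by rewrite sat_flift sat_fren comp_copair. Qed.

Lemma pair_transfer_imp (m : nat) (W : Type) (phi psi : formula L ('I_m + W))
    (e : W -> U) :
  (forall n : 'I_m -> U, (forall i, M (n i)) ->
     sat phi (copair n e) -> sat psi (copair n e)) ->
  forall n : 'I_m -> N', (forall i, N (n i)) ->
     sat phi (copair n (j \o e)) -> sat psi (copair n (j \o e)).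
Proof.
move=> imp n Nn; rewrite -!(sat_swap N); apply: pair_transfer => // a Ma.
by rewrite !(sat_swap M); exact: imp.
Qed.

Lemma pair_transfer_exists (m k : nat) (W : Type) (phi : formula L ('I_m + W))
    (psi : formula L ('I_k + ('I_m + W))) (e : W -> U) :
  (forall n : 'I_m -> U, (forall i, M (n i)) -> sat phi (copair n e) ->
     exists a, (forall i, M (a i)) /\ sat psi (copair a (copair n e))) ->
  forall n : 'I_m -> N', (forall i, N (n i)) -> sat phi (copair n (j \o e)) ->
     exists a, (forall i, N (a i)) /\ sat psi (copair a (copair n (j \o e))).
Proof.
pose psi' : formula (lang_pred L) (W + 'I_m) := Fexn_pred (flift
  (fren (copair inr (inl \o copair inr inl)) psi)).
have psi'E (S : structure L) (P : set S) (n : 'I_m -> S) (f : W -> S) :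
    sat_pair P psi' (copair f n) <->
    exists a, (forall i, P (a i)) /\ sat psi (copair a (copair n f)).
  rewrite sat_Fexn_pred; split=> -[a] Pa; exists a; move: Pa;
    by rewrite sat_flift sat_fren !comp_copair.
move=> ex_a n Nn; rewrite -(sat_swap N) => phi_n; apply/psi'E.
apply: pair_transfer phi_n => // a Ma.
by rewrite (sat_swap M) psi'E; exact: ex_a.
Qed.
End PairExtension.

(** * Countable extensions of the base model *)

Definition countable_ext (T : Type) (A B : set T) : Prop :=
  A `<=` B /\ countable (B `\` A).

Lemma countable_ext_refl (T : Type) (A : set T) : countable_ext A A.
Proof. by split=> //; rewrite setDv. Qed.

Lemma countable_ext_setU (T : Type) (A B B' : set T) :
  countable_ext A B -> countable_ext A B' -> countable_ext A (B `|` B').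
Proof.
move=> [AB cB] [_ cB']; split; first exact: subset_trans (@subsetUl _ _ _).
by rewrite setDUl; exact: countable_setU.
Qed.

Lemma countable_ext_setUr (T : Type) (A B D : set T) :
  countable_ext A B -> countable D -> countable_ext A (B `|` D).
Proof.
move=> [AB cB] cD; split; first exact: subset_trans (@subsetUl _ _ _).
rewrite setDUl; apply: countable_setU => //.
exact: sub_countable (subset_card_le (@subDsetl _ _ _)) cD.
Qed.

Lemma countable_range (T : Type) (I : countType) (d : I -> T) :
  countable (range d).
Proof. exact: sub_countable (card_image_le _ _) (countableP _). Qed.

Section SmallModel.
Variables (L : language) (U : structure L) (M : set U).
Hypothesis HM : elem_substructure M.
Hypothesis satU : saturated (countable_ext M).

Lemma countable_ext_range (I : countType) (d : I -> U) :
  countable_ext M (M `|` range d).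
Proof.
exact: countable_ext_setUr (countable_ext_refl M) (countable_range d).
Qed.

(** * Coheirs of definable types under NIP *)

Variable T : set (sentence L).
Hypothesis TU : model_of T U.

Section Patterns.
Variables k n : nat.
Variables (theta : formula L ('I_k + 'I_n)) (a : nat -> 'I_k -> U).
Hypothesis finite_patterns : forall (m : nat) (beta : nat -> bool),
  exists y, forall i, (i < m)%N -> (sat theta (copair (a i) y) <-> beta i).

Lemma realize_pattern (beta : nat -> bool) :
  exists y, forall i, sat theta (copair (a i) y) <-> beta i.
Proof.
pose constr i := inst (fren (copair inr inl)
  (if beta i then theta else Fnot theta)) (a i).
have constrE i y :
    holds (constr i) y <-> (sat theta (copair (a i) y) <-> beta i).
  rewrite holds_inst sat_fren comp_copair.
  by case: (beta i) => /=; split=> [|[]]; intuition.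
have extMa := countable_ext_range (fun z : nat * 'I_k => a z.1 z.2).
have [|S0 finS0 S0S|y sat_y] := satU extMa (S := range constr).
- move=> _ [i _ <-]; apply: over_sub (over_inst_range _ (a i)) => _ [l _ <-].
  by right; exists (i, l).
- pose upto m := [set constr i | i in `I_m].
  have [||m S0m] := finite_set_directed (P := upto) 0%N _ finS0.
  + move=> m m'; exists (maxn m m') => _ [] [i im <-]; exists i => //;
      by rewrite /= leq_max im ?orbT.
  + by move=> _ /S0S[i _ <-]; exists i.+1; exists i => /=.
  have [y y_m] := finite_patterns m beta.
  by exists y; split=> // _ /S0m[i im <-]; apply/constrE; exact: y_m.
- by exists y => i; apply/constrE; apply: sat_y; exists i.
Qed.

Lemma finite_patterns_not_NIP : ~ NIP T.
Proof.
move=> HNIP; have a_inj : injective a.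
  move=> i l ail; have [y y_i] := realize_pattern (fun x => x == i).
  have := iffRL (y_i i) (eqxx i).
  by rewrite ail => /(iffLR (y_i l))/eqP->.
have inf_a : infinite_set (range a).
  rewrite (eq_finite_set (B := [set: nat])); first exact: infinite_nat.
  by apply: inj_card_eq => x y _ _; exact: a_inj.
apply: (HNIP U TU _ _ theta _ inf_a) => B _.
have [y y_B] := realize_pattern (fun i => `[< B (a i) >]).
by exists y => _ [i _ <-]; rewrite -[B _]asboolE; exact: y_B.
Qed.
End Patterns.

Hypothesis HNIP : NIP T.

Section Coheirs.
Variable k : nat.
Implicit Types (r : set (formula L ('I_k + U))) (X : set ('I_k -> U)).

Section MorleySequences.
Variables (r : set (formula L ('I_k + U))) (cr : complete_type r).
Implicit Types (a : nat -> 'I_k -> U) (v : nat * 'I_k -> U).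
Implicit Types (Y : set (nat * 'I_k -> U)).

Definition morley_base a (n : nat) : set U := M `|` \bigcup_(i < n) range (a i).

Definition morley_sequence a : Prop :=
  forall n, realizes_over r (morley_base a n) (a n).

Lemma exists_morley_sequence : exists a, morley_sequence a.
Proof.
have /choice[next nextP] B : exists b, countable_ext M B -> realizes_over r B b.
  have [extB|] := pselect (countable_ext M B).
    by have [b rb] := exists_realizes_over cr satU extB; exists b.
  by have [u] := carrier_inhabited U; exists (fun=> u).
pose base := fix base n :=
  if n is m.+1 then base m `|` range (next (base m)) else M.
have ext_base n : countable_ext M (base n).
  elim: n => [|n IH]; first exact: countable_ext_refl.
  exact: countable_ext_setUr IH (countable_range _).
exists (fun n => next (base n)) => n.
apply: realizes_over_sub (nextP _ (ext_base n)).
rewrite subUset; split; first exact: (ext_base n).1.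
move=> x [i /= lt_in]; elim: n lt_in => // n IH; rewrite ltnS leq_eqVlt.
by move=> /predU1P[->|/IH sub_in] xi; [right|left; exact: sub_in].
Qed.

Definition set_slot v (i : nat) (x : 'I_k -> U) : nat * 'I_k -> U :=
  fun z => if z.1 == i then x z.2 else v z.

Lemma definable_set_slot A Y i : definable A Y ->
  definable A (fun w : 'I_k + nat * 'I_k -> U =>
    Y (set_slot (w \o inr) i (w \o inl))).
Proof.
move=> /(definable_rename (fun z => if z.1 == i then inl z.2 else inr z)).
apply: eq_definable => w.
rewrite (_ : w \o _ = set_slot (w \o inr) i (w \o inl)) //.
by apply: funext => z; rewrite /set_slot /=; case: ifP.
Qed.

Lemma definable_set_slot_at A B Y v i :
  A `<=` B -> (forall z, B (v z)) -> definable A Y ->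
  definable B (fun x => Y (set_slot v i x)).
Proof. by move=> AB Bv /(definable_set_slot i); exact: definable_param_sub. Qed.

Definition splits_traces X : Prop := forall chi (b : bool), definable M chi ->
  most r chi -> exists x, [/\ forall i, M (x i), chi x & (X x <-> b)].

Definition truncate a (u0 : U) (m : nat) : nat * 'I_k -> U :=
  fun z => if (z.1 < m)%N then a z.1 z.2 else u0.

Lemma truncateS a u0 m :
  truncate a u0 m.+1 = set_slot (truncate a u0 m) m (a m).
Proof.
apply: funext => z; rewrite /set_slot /truncate ltnS leq_eqVlt.
by case: eqVneq => // ->.
Qed.

Lemma truncate_morley_base a u0 m z :
  M u0 -> morley_base a m (truncate a u0 m z).
Proof.
rewrite /truncate; case: ifP => [lt_zm _|_]; last by left.
by right; exists z.1; last exists z.2.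
Qed.

(* Any M-definable property of a Morley sequence holds of some tuples of [M]
   which moreover realize a prescribed pattern of [X]: they are chosen by
   replacing the terms of the sequence one by one, starting from the last. *)
Lemma morley_pattern a X (beta : nat -> bool) u0 (m : nat) Y :
  definable_over M r -> morley_sequence a -> splits_traces X -> M u0 ->
  definable M Y -> Y (truncate a u0 m) ->
  exists v, [/\ forall z, M (v z), Y v &
    forall i, (i < m)%N -> (X (fun l => v (i, l)) <-> beta i)].
Proof.
move=> dr ma splitX Mu0; elim: m Y => [|m IH] Y DY.
  by exists (truncate a u0 0); split=> // z; rewrite /truncate.
have DYm := definable_most cr dr (definable_set_slot m DY).
have DYa : definable (morley_base a m)
    (fun x => Y (set_slot (truncate a u0 m) m x)).
  apply: definable_set_slot_at (@subsetUl _ _ _) _ DY => z.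
  exact: truncate_morley_base.
rewrite truncateS => /(realizes_overE cr (ma m) DYa)/(IH _ DYm).
move=> [v [Mv rY v_beta]].
have DYv := definable_set_slot_at m (@subset_refl _ M) Mv DY.
have [x [Mx Yx x_beta]] := splitX _ (beta m) DYv rY.
exists (set_slot v m x); split=> // [z|i].
  by rewrite /set_slot; case: ifP.
rewrite ltnS leq_eqVlt /set_slot /= => /predU1P[->|lt_im].
  by rewrite eqxx.
by rewrite (ltn_eqF lt_im); exact: v_beta.
Qed.
End MorleySequences.

(* When [r] is definable over [M] in a NIP theory, the definable [X] such that
   [coheir r X] form the unique coheir of the restriction of [r] to [M]. *)
Definition coheir r X : Prop :=
  exists2 chi, definable M chi /\ most r chi &
    forall a, (forall i, M (a i)) -> chi a -> X a.

Lemma coheir_decides_or_splits r X :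
  [\/ coheir r X, coheir r (fun a => ~ X a) | splits_traces r X].
Proof.
have [?|nX] := pselect (coheir r X); first exact: Or31.
have [?|nnX] := pselect (coheir r (fun a => ~ X a)); first exact: Or32.
apply: Or33 => chi b Dchi rchi; apply: contrapT => no_a.
case: b no_a => no_a; [apply: nnX|apply: nX]; exists chi => // a Ma chia.
  by move=> Xa; apply: no_a; exists a.
by apply: contrapT => nXa; apply: no_a; exists a.
Qed.

Lemma splits_finite_patterns r n (theta : formula L ('I_k + 'I_n)) d a :
  complete_type r -> definable_over M r -> morley_sequence r a ->
  splits_traces r (holds (inst theta d)) ->
  forall m (beta : nat -> bool),
    exists y, forall i, (i < m)%N -> (sat theta (copair (a i) y) <-> beta i).
Proof.
move=> cr dr ma split_theta m beta.
have [u0 Mu0] := elem_substructure_nonempty HM.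
pose pattern_at (i : 'I_m) (v : nat * 'I_k + 'I_n -> U) :=
  sat theta (v \o copair (fun l => inl (nat_of_ord i, l)) inr) <-> beta i.
pose has_pattern v := exists y, forall i, pattern_at i (copair v y).
have Dpattern : definable M has_pattern.
  apply: (definable_exists (X := fun w => forall i, pattern_at i w)).
  apply: definable_forall_fin => i; apply: definable_iff (definable_cst _ _ _).
  exact: definable_rename (definable_sat M theta).
have pattern_atE i v y : pattern_at i (copair v y) <->
    (sat theta (copair (fun l => v (nat_of_ord i, l)) y) <-> beta i).
  by rewrite /pattern_at comp_copair.
have [|npattern] := pselect (has_pattern (truncate a u0 m)).
  move=> [y y_beta]; exists y => i lt_im.
  by have := y_beta (Ordinal lt_im); rewrite pattern_atE /truncate /= lt_im.
have [v [_ nv v_beta]] := morley_pattern cr beta dr ma split_theta Mu0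
  (definable_not Dpattern) npattern.
case: nv; exists d => i; rewrite pattern_atE -holds_inst.
exact: v_beta (ltn_ord i).
Qed.

(* If [X = theta(-, d)] split the traces of [r] on [M], then [theta] would
   shatter a Morley sequence of [r]. *)
Lemma coheir_decides r X :
  complete_type r -> definable_over M r ->
  definable setT X -> coheir r X \/ coheir r (fun a => ~ X a).
Proof.
move=> cr dr /definableP[phi _ XE].
have [m [theta [d phiE]]] := exists_inst phi.
have -> : X = holds (inst theta d) by apply/predeqP => a; rewrite XE phiE.
have [?|?|split_theta] := coheir_decides_or_splits r (holds (inst theta d)).
- by left.
- by right.
have [a ma] := exists_morley_sequence cr.
have patterns := splits_finite_patterns cr dr ma split_theta.
by have := finite_patterns_not_NIP patterns HNIP.
Qed.

Lemma coheir_definable r X : definable M X -> (coheir r X <-> most r X).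
Proof.
move=> DX; split=> [[chi [Dchi rchi] chiX]|rX]; last by exists X.
apply: most_mono rchi.
exact: (Tarski_Vaught_forall HM (definable_imp Dchi DX)).
Qed.

Section CoheirFilter.
Variables (r : set (formula L ('I_k + U))) (cr : complete_type r).

Lemma coheir_sat X : coheir r X -> exists a, (forall i, M (a i)) /\ X a.
Proof.
move=> [chi [Dchi rchi] chiX].
have [a [Ma chia]] := Tarski_Vaught HM Dchi (most_exists cr rchi).
by exists a; split=> //; exact: chiX.
Qed.

Lemma coheir_and X Y :
  coheir r X -> coheir r Y -> coheir r (fun a => X a /\ Y a).
Proof.
move=> [chi [Dchi rchi] chiX] [xi [Dxi rxi] xiY].
exists (fun a => chi a /\ xi a).
  by split; [exact: definable_and|exact: most_and].
by move=> a Ma [/chiX ? /xiY]; auto.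
Qed.
End CoheirFilter.
End Coheirs.

(** * The retraction onto finitely satisfiable types *)

Variables (N' : structure L) (N : set N') (j : U -> N').
Hypothesis elem_pair :
  @elementary (lang_pred L) (pair_structure M) (pair_structure N) j.
Let elem_j : elementary j := pair_elementary elem_pair.

Section Push.
Variable k : nat.

Lemma push_inst m (psi : formula L ('I_k + 'I_m)) (d : 'I_m -> U) :
  push j (inst psi d) = inst psi (j \o d).
Proof.
by rewrite /push /inst fren_comp; congr fren; apply: funext; case.
Qed.

Lemma holds_push (phi : formula L ('I_k + U)) a :
  holds (push j phi) a = sat phi (copair a j).
Proof. by rewrite /push holdsE sat_fren; congr sat; apply: funext; case. Qed.

Lemma over_imageE A (psi : formula L ('I_k + N')) :
  over (j @` A) psi <-> exists2 phi, over A phi & psi = push j phi.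
Proof.
split=> [[m [chi [e [je ->]]]]|[_ [m [chi [d [Ad ->]]]] ->]]; last first.
  exists m, chi, (j \o d); split=> [i|]; [by exists (d i)|exact: push_inst].
have /choice[d dP] i : exists u, A u /\ j u = e i.
  by case: (je i) => u; exists u.
exists (inst chi d); first by exists m, chi, d; split=> // i; exact: (dP i).1.
by rewrite push_inst; congr inst; apply: funext => i; rewrite /= (dP i).2.
Qed.
End Push.

Lemma exists_equiv_over_image m (n : 'I_m -> N') :
  exists c : 'I_m -> U, equiv_over (j @` M) n (j \o c).
Proof.
pose S := [set phi : formula L ('I_m + U) | over M phi /\ sat phi (copair n j)].
have [phi []//||c Sc] := satU (countable_ext_refl M) (S := S).
  apply: fin_sat_in_directed => [|phi [_ nphi]].
    apply: directed_and => [|phi psi [Mphi nphi] [Mpsi npsi]].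
      by exists (Ftrue L _); split; [exact: over_true|exact: sat_Ftrue].
    by split; first exact: over_and.
  have : sat (Fexn (fren (copair inr inl) phi)) j.
    by apply/sat_Fexn; exists n; rewrite sat_fren comp_copair.
  move=> /(elem_j _ id)/sat_Fexn[a]; rewrite sat_fren comp_copair.
  by exists a.
exists c => _ /over_imageE[phi Mphi ->]; rewrite !holds_push.
rewrite -[j in X in _ <-> sat _ X]/(j \o id) -comp_copair -elem_j -holdsE.
split=> [nphi|phi_c]; first exact: Sc.
apply: contrapT => nphi; apply: (Sc (Fnot phi)) phi_c.
by split=> //; exact: over_not.
Qed.

Section Retraction.
Variable k : nat.
Implicit Types (r q : set (formula L ('I_k + U))) (X : set ('I_k -> U)).

Lemma inv_extension_unique r (r1 r2 : set (formula L ('I_k + N'))) :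
  complete_type r ->
  inv_extension M j r r1 -> inv_extension M j r r2 -> r1 = r2.
Proof.
move=> cr [cr1 ext1 inv1] [cr2 ext2 inv2].
apply: complete_type_eq => // phi; have [m [psi [n ->]]] := exists_inst phi.
have [c nc] := exists_equiv_over_image n.
rewrite (inv1 _ _ _ _ nc) (inv2 _ _ _ _ nc) -push_inst.
have [/ext2//|/ext1 r1n r1p] := cr.2 (inst psi c).
by have [a [? ? []]] := complete_type_sat3 cr1 r1p r1n r1n.
Qed.

Section DefinableExtension.
Variable r : set (formula L ('I_k + U)).
Hypotheses (cr : complete_type r) (dr : definable_over M r).

Definition defines (V : Type) (psi : formula L ('I_k + V))
    (delta : formula L (V + M)) : Prop :=
  forall v, most r (fun a => sat psi (copair a v)) <-> sat delta (copair v val).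

Lemma exists_defines (V : Type) (psi : formula L ('I_k + V)) :
  exists delta, defines psi delta.
Proof. exact: definable_most cr dr (definable_sat M psi). Qed.

(* Seeing the parameters in [N'] as variables, the definitions of [r] apply to
   the formulas over [N'] as well. *)
Let def_of (psi : formula L ('I_k + N')) : formula L (N' + M) :=
  sval (cid (exists_defines psi)).

Let def_ofP psi : defines psi (def_of psi) := svalP (cid (exists_defines psi)).

Definition definable_ext : set (formula L ('I_k + N')) :=
  [set psi | sat (def_of psi) (copair id (j \o val))].

Lemma definable_ext_inst m (psi : formula L ('I_k + 'I_m)) delta n :
  defines psi delta ->
  definable_ext (inst psi n) <-> sat delta (copair n (j \o val)).
Proof.
move=> deltaP; have sat_inst (S : structure L) (v : N' -> S) (e : M -> S) :
    sat (fren (copair (inl \o n) inr) delta) (copair v e) =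
    sat delta (copair (v \o n) e).
  by rewrite sat_fren comp_copair.
rewrite -(sat_inst _ id).
have defE v : sat (def_of (inst psi n)) (copair v val) <->
    sat (fren (copair (inl \o n) inr) delta) (copair v val).
  rewrite sat_inst -deltaP -def_ofP; apply: eq_most => a.
  by rewrite sat_fren comp_copair.
by split; apply: (elementary_imp elem_j (e := val)) => v /defE.
Qed.

Lemma complete_definable_ext : complete_type definable_ext.
Proof.
apply: complete_type_intro => [phi psi ext_phi ext_psi|phi|phi].
- apply: (elementary_imp elem_j (phi := Fand (def_of phi) (def_of psi))) => //.
  by move=> v [/def_ofP rphi /def_ofP rpsi]; apply/def_ofP/most_and.
- move=> ext_phi; suff : sat (Fexn (fren (copair inr (inl \o inl)) phi))
      (copair id (j \o val : M -> N')).
    by move=> /sat_Fexn[a]; rewrite sat_fren comp_copair; exists a.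
  apply: elementary_imp ext_phi => // v /def_ofP/(most_exists cr)[a phi_a].
  by apply/sat_Fexn; exists a; rewrite sat_fren comp_copair.
- have [ext_phi|next_phi] := pselect (definable_ext phi); [by left|right].
  apply: (elementary_imp elem_j (phi := Fnot (def_of phi))) => // v.
  rewrite /= -def_ofP => nphi; apply/def_ofP/most_not => //.
  exact: (definable_param (fun=> I) (definable_sat setT phi)).
Qed.

Lemma inv_extension_definable_ext : inv_extension M j r definable_ext.
Proof.
split; first exact: complete_definable_ext.
- move=> phi; have [m [psi [d ->]]] := exists_inst phi.
  have [delta deltaP] := exists_defines psi.
  rewrite push_inst (definable_ext_inst _ deltaP) most_holds //.
  rewrite -comp_copair -elem_j -deltaP; apply: most_mono => a.
  by rewrite holds_inst.
- move=> m psi b c /equiv_overE bc; have [delta deltaP] := exists_defines psi.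
  rewrite !(definable_ext_inst _ deltaP).
  have jM (x : M) : (j @` M) (j (val x)).
    by exists (val x) => //; exact: set_valP.
  exact: (bc _ (definable_param jM (definable_sat _ delta))).
Qed.

Lemma inv_restrE : inv_restr M N j r = restr N definable_ext.
Proof.
apply/predeqP => phi; split=> [[r' [er' r'phi]]|ext_phi].
  by rewrite -(inv_extension_unique cr er' inv_extension_definable_ext).
by exists definable_ext; split=> //; exact: inv_extension_definable_ext.
Qed.
End DefinableExtension.

Section DefinableTypes.
Variable r : set (formula L ('I_k + U)).
Hypotheses (cr : complete_type r) (dr : definable_over M r).
Local Notation r' := (definable_ext cr dr).

(* The definition of [psi] turns the claim into a first-order property of the
   pair, so it suffices to check it in [(U, M)]. *)
Lemma coheir_definable_ext_sat theta m (psi : formula L ('I_k + 'I_m)) n :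
  coheir r (holds theta) -> (forall i, N (n i)) -> r' (inst psi n) ->
  exists a, (forall i, N (a i)) /\ holds (Fand (push j theta) (inst psi n)) a.
Proof.
move=> [chi [Dchi rchi] chi_theta] Nn.
have [delta deltaP] := exists_defines cr dr psi.
move=> /(definable_ext_inst cr dr n deltaP) delta_n.
pose both : formula L ('I_k + ('I_m + U)) := Fand
  (fren (copair inl (inr \o inr)) theta) (fren (copair inl (inr \o inl)) psi).
have bothE (S : structure L) (a : 'I_k -> S) (b : 'I_m -> S) (e : U -> S) :
    sat both (copair a (copair b e)) =
    (sat theta (copair a e) /\ sat psi (copair a b)).
  by rewrite /= !sat_fren !comp_copair.
have [b Mb||a [Na]] := pair_transfer_exists elem_pair (e := id)
  (phi := fren (copair inl (inr \o val)) delta) (psi := both) _ Nn.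
- rewrite sat_fren comp_copair -deltaP => rpsi.
  have Dboth := definable_and Dchi (definable_param Mb (definable_sat M psi)).
  have [a [Ma [chi_a psi_a]]] :=
    Tarski_Vaught HM Dboth (most_exists cr (most_and cr rchi rpsi)).
  by exists a; rewrite bothE; split=> //; split=> //; exact: chi_theta.
- by rewrite sat_fren comp_copair.
- by rewrite bothE -holds_push -holds_inst; exists a.
Qed.

Let push_definable_ext phi : r phi -> r' (push j phi).
Proof. by case: (inv_extension_definable_ext cr dr) => _ + _; exact. Qed.

Let over_push (phi : formula L ('I_k + U)) : over M phi -> over N (push j phi).
Proof.
move=> Mphi; apply: over_sub (pair_image_sub elem_pair) _.
by apply/over_imageE; exists phi.
Qed.

Lemma coheir_F_map theta : coheir r (holds theta) -> F_map M N j r theta.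
Proof.
move=> r_theta; rewrite /F_map /= (inv_restrE cr dr).
apply: fin_sat_in_adjoin => [|phi [rphi [m [psi [n [Nn phiE]]]]]]; last first.
  by rewrite phiE in rphi *; exact: coheir_definable_ext_sat.
apply: directed_and => [|phi psi [rphi Nphi] [rpsi Npsi]].
  exists (push j (Ftrue L _)); split; last exact/over_push/over_true.
  apply/push_definable_ext/most_holds => //.
  by apply: most_mono (most_true cr) => a _; exact: sat_Ftrue.
split; last exact: over_and.
exact: (complete_type_and (complete_definable_ext cr dr)).
Qed.

Lemma F_mapE theta : F_map M N j r theta <-> coheir r (holds theta).
Proof.
split=> [|r_theta]; last exact: coheir_F_map.
rewrite /F_map /= (inv_restrE cr dr) => sat_theta.
have [//|[chi [/definableP[phi Mphi chiE] rchi] chi_ntheta]] :=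
  coheir_decides cr dr (definable_holds (over_setT theta)).
have rphi : r phi by apply/most_holds/(eq_most _ chiE).
have [||a [Na sat_a]] := sat_theta [set push j theta; push j phi].
- exact: finite_set2.
- move=> _ [->|->]; first by left.
  by right; split; [exact: push_definable_ext|exact: over_push].
have : holds (push j theta) a by apply: sat_a; left.
have : holds (push j phi) a by apply: sat_a; right.
rewrite !holds_push => phi_a theta_a.
case: (pair_transfer_imp elem_pair (e := id) (psi := Fnot theta)
  _ Na phi_a) => //.
by move=> b Mb /chiE; exact: chi_ntheta.
Qed.

Local Notation F := (F_map M N j).

Lemma F_map_complete : complete_type (F r).
Proof.
apply: complete_type_intro => [phi psi|phi|phi]; rewrite !F_mapE.
- exact: coheir_and.
- by move=> /(coheir_sat cr)[a [_ phi_a]]; exists a.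
- exact: coheir_decides cr dr (definable_holds (over_setT phi)).
Qed.

Lemma F_map_fin_sat : fin_sat_in M (F r).
Proof.
apply: fin_sat_in_directed (complete_type_directed F_map_complete) _ => phi.
by move=> /F_mapE/(coheir_sat cr).
Qed.

Lemma most_F_map X : definable M X -> (most (F r) X <-> most r X).
Proof.
move=> DX; have /definableP[phi _ XE] := DX.
rewrite (eq_most _ XE) -most_holds; last exact: F_map_complete.
rewrite F_mapE -(coheir_definable r DX); split=> -[chi Dchi chiX];
  by exists chi => // a Ma /(chiX a Ma)/XE.
Qed.

Lemma F_map_unique q : complete_type q -> fin_sat_in M q ->
  (forall X, definable M X -> most r X -> most q X) -> F r = q.
Proof.
move=> cq fsq rq; apply: (complete_type_eq F_map_complete cq) => phi.
move=> /F_mapE[chi [Dchi /(rq _ Dchi) q_chi] chi_phi].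
have [//|/(most_holds cq) q_nphi] := cq.2 phi.
have [a [Ma [/(chi_phi a Ma) phi_a]]] :=
  most_fin_sat fsq (most_and cq q_chi q_nphi).
by case.
Qed.
End DefinableTypes.
End Retraction.

(** * The semigroup of invariant types *)

Section GroupTypes.
Variables (k : nat) (G : definable_group U k).
Implicit Types (p q r s : set (formula L ('I_k + U))) (X : set ('I_k -> U)).
Implicit Types (B C : set U) (b c g h : gpoint G) (Y Z : set (gpoint G)).

Local Open Scope group_scope.
Local Notation "p ** q" := (newelski G M p q) (at level 40).
Local Notation "p .* c" := (rtranslate G p (gtuple c)) (at level 40).

Lemma exists_gpoint_realizes q B : S_G G q -> countable_ext M B ->
  exists b : gpoint G, realizes_over q B b.
Proof.
move=> Sq extB; have [b rb] := exists_realizes_over Sq.1 satU extB.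
by exists (GPoint (realizes_over_inG Sq rb)).
Qed.

Lemma exists_gpoint_realizes_model q : S_G G q ->
  exists b : gpoint G, realizes_over q M b.
Proof. by move=> Sq; exact: exists_gpoint_realizes (countable_ext_refl M). Qed.

Lemma exists_over_countable_ext (phi : formula L ('I_k + U)) :
  exists2 B, countable_ext M B & over B phi.
Proof.
have [m [psi [d ->]]] := exists_inst phi.
exists (M `|` range d); first exact: countable_ext_range.
by apply: over_sub (over_inst_range psi d); exact: subsetUr.
Qed.

Lemma mostG_mulr_realizes p q B X b c :
  S_inv G M p -> complete_type q -> M `<=` B -> definable B X ->
  realizes_over q B b -> realizes_over q B c ->
  mostG p (fun a => X (a * b)) -> mostG p (fun a => X (a * c)).
Proof.
move=> [Sp ip] cq MB DX rb rc.
have DR := definable_rename (inl : _ -> 'I_k + 'I_k) DX.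
exact: (mostG_same_type (x := id) Sp (invariant_sub MB ip) DR
  (same_type_realizes_over cq rb rc)).
Qed.

Lemma mostG_mulr_indep p q B C X b c :
  S_inv G M p -> S_inv G M q -> countable_ext M B -> countable_ext M C ->
  definable B X -> definable C X ->
  realizes_over q B b -> realizes_over q C c ->
  mostG p (fun a => X (a * b)) -> mostG p (fun a => X (a * c)).
Proof.
move=> Sp [Sq _] extB extC DBX DCX rb rc.
have [e re] := exists_gpoint_realizes Sq (countable_ext_setU extB extC).
have [reB reC] : realizes_over q B e /\ realizes_over q C e.
  by split; apply: realizes_over_sub re; [exact: subsetUl|exact: subsetUr].
move=> /(mostG_mulr_realizes Sp Sq.1 extB.1 DBX rb reB).
exact: mostG_mulr_realizes Sp Sq.1 extC.1 DCX reC rc.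
Qed.

Lemma newelskiE p q B phi b :
  S_inv G M p -> S_inv G M q -> countable_ext M B -> over B phi ->
  realizes_over q B b ->
  ((p ** q) phi <-> mostG p (fun a => holds phi (a * b))).
Proof.
move=> Sp Sq extB Bphi rb; have DBphi := definable_holds Bphi.
have Dinst m (psi : formula L ('I_k + 'I_m)) (d : 'I_m -> U) :
    definable (M `|` range d) (holds (inst psi d)).
  by apply/definable_holds/over_sub/over_inst_range; exact: subsetUr.
split=> [[m [psi [d [c [phiE /(realizes_restrE Sq.1.1) rc]]]]]|pb].
  move=> /(rtranslateE Sp.1 (GPoint (realizes_over_inG Sq.1 rc))).
  rewrite -phiE.
  apply: (mostG_mulr_indep Sp Sq (countable_ext_range d) extB) => //.
  by rewrite phiE; exact: Dinst.
have [m [psi [d phiE]]] := exists_inst phi.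
have [c rc] := exists_gpoint_realizes Sq.1 (countable_ext_range d).
exists m, psi, d, c; split=> //; first exact/(realizes_restrE Sq.1.1).
apply/(rtranslateE Sp.1); rewrite -phiE.
apply: (mostG_mulr_indep Sp Sq extB (countable_ext_range d) _ _ rb rc pb) => //.
by rewrite phiE; exact: Dinst.
Qed.

Lemma newelski_complete p q :
  S_inv G M p -> S_inv G M q -> complete_type (p ** q).
Proof.
move=> Sp Sq; apply: complete_type_intro => [phi psi|phi|phi].
- have [B extB Bphi] := exists_over_countable_ext phi.
  have [C extC Cpsi] := exists_over_countable_ext psi.
  have extBC := countable_ext_setU extB extC.
  have {}Bphi := over_sub (@subsetUl _ B C) Bphi.
  have {}Cpsi := over_sub (@subsetUr _ B C) Cpsi.
  have [b rb] := exists_gpoint_realizes Sq.1 extBC.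
  have inE chi := @newelskiE p q _ chi b Sp Sq extBC ^~ rb.
  rewrite !inE //; last exact: over_and.
  exact: mostG_and Sp.1 _ _.
- have [B extB Bphi] := exists_over_countable_ext phi.
  have [b rb] := exists_gpoint_realizes Sq.1 extB.
  move=> /(newelskiE Sp Sq extB Bphi rb)/(mostG_fin_sat Sp.1 Sp.1.1.1)[g _].
  by exists (g * b).
- have [B extB Bphi] := exists_over_countable_ext phi.
  have [b rb] := exists_gpoint_realizes Sq.1 extB.
  rewrite (newelskiE Sp Sq extB Bphi rb).
  rewrite (newelskiE Sp Sq extB (over_not Bphi) rb).
  have Dphi := definableG_holds G (over_setT phi).
  rewrite (mostG_not Sp.1 (definableG_mulr (h := b) _ Dphi)) //.
  exact: EM.
Qed.

Let most_newelski p q B X b :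
  S_inv G M p -> S_inv G M q -> countable_ext M B -> definable B X ->
  realizes_over q B b -> (most (p ** q) X <-> mostG p (fun a => X (a * b))).
Proof.
move=> Sp Sq extB /definableP[phi Bphi XE] rb.
rewrite (eq_most _ XE) -most_holds; last exact: newelski_complete.
by rewrite (newelskiE Sp Sq extB Bphi rb); apply: eq_mostG => a; rewrite XE.
Qed.

Lemma newelski_S_G p q : S_inv G M p -> S_inv G M q -> S_G G (p ** q).
Proof.
move=> Sp Sq; apply: S_G_intro; first exact: newelski_complete.
have [b rb] := exists_gpoint_realizes_model Sq.1.
apply/(most_newelski Sp Sq (countable_ext_refl M) _ rb).
  exact: definable_sat.
by apply: mostG_mono (mostG_inG Sp.1) => a _; exact: gtuple_inG.
Qed.

Lemma mostG_newelski p q B Y b :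
  S_inv G M p -> S_inv G M q -> countable_ext M B -> definableG B Y ->
  realizes_over q B b -> (mostG (p ** q) Y <-> mostG p (fun a => Y (a * b))).
Proof.
move=> Sp Sq extB [X DX YX] rb.
rewrite (eq_mostG _ YX) (mostG_gtuple (newelski_S_G Sp Sq)).
by rewrite (most_newelski Sp Sq extB DX rb); apply: eq_mostG => a; rewrite YX.
Qed.

Lemma newelski_S_inv p q : S_inv G M p -> S_inv G M q -> S_inv G M (p ** q).
Proof.
move=> Sp Sq; split=> [|n phi d d' /equiv_overE dd']; first exact: newelski_S_G.
suff transfer (e e' : 'I_n -> U) :
    same_type M e e' -> (p ** q) (inst phi e) -> (p ** q) (inst phi e').
  by split; apply: transfer; last exact: same_type_sym.
move=> {d d' dd'} ee'.
have inst_over (d : 'I_n -> U) : over (M `|` range d) (inst phi d).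
  by apply: over_sub (over_inst_range phi d); exact: subsetUr.
have [b rb] := exists_gpoint_realizes Sq.1 (countable_ext_range e).
have [b' rb'] := exists_gpoint_realizes Sq.1 (countable_ext_range e').
rewrite (newelskiE Sp Sq (countable_ext_range e) (inst_over e) rb).
rewrite (newelskiE Sp Sq (countable_ext_range e') (inst_over e') rb').
pose R : formula L ('I_k + ('I_k + 'I_n)) := fren (copair inl (inr \o inr)) phi.
have instE (d : 'I_n -> U) c : mostG p (fun a => holds (inst phi d) (a * c)) <->
    mostG p (fun a => sat R (copair (a * c)%g (copair c d))).
  by apply: eq_mostG => a; rewrite holds_inst sat_fren comp_copair.
rewrite !instE; apply: (mostG_same_type (x := inl) Sp.1 Sp.2) => //.
  exact: definable_sat.
exact: same_type_copair_realizes Sq.1.1 Sq.2 ee' rb rb'.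
Qed.

Lemma newelskiA p q r : S_inv G M p -> S_inv G M q -> S_inv G M r ->
  p ** (q ** r) = (p ** q) ** r.
Proof.
move=> Sp Sq Sr.
have [Spq Sqr] := (newelski_S_inv Sp Sq, newelski_S_inv Sq Sr).
apply: complete_type_eq; [exact: newelski_complete..|].
move=> phi; have [B extB Bphi] := exists_over_countable_ext phi.
have [c rc] := exists_gpoint_realizes Sr.1 extB.
have extBc := countable_ext_setUr extB (countable_range c).
have [b rb] := exists_gpoint_realizes Sq.1 extBc.
have Dmulc Y :
    definableG B Y -> definableG (B `|` range c) (fun a => Y (a * c)).
  move=> /(definableG_sub (@subsetUl _ _ (range c))).
  by apply: definableG_mulr => i; right; exists i.
have rbc : realizes_over (q ** r) B (b * c)%g.
  move=> X DX; have DGX := definableG_gtuple G DX.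
  rewrite -(mostG_gtuple Sqr.1) (mostG_newelski Sq Sr extB DGX rc).
  by rewrite -(mostG_realizes_over Sq.1 rb (Dmulc _ DGX)).
have Dphi := definableG_holds G Bphi.
rewrite (newelskiE Sp Sqr extB Bphi rbc) (newelskiE Spq Sr extB Bphi rc).
rewrite (mostG_newelski Sp Sq extBc (Dmulc _ Dphi) rb).
by apply: mostG_mono => a; rewrite mulgA.
Qed.

Lemma S_fs_sub_S_inv : S_fs G M `<=` S_inv G M.
Proof.
by move=> p [Sp fsp]; split=> //; exact: fin_sat_in_invariant Sp.1 fsp.
Qed.

Lemma gpoint_mul_model g h :
  (forall i, M (g i)) -> (forall i, M (h i)) -> forall i, M ((g * h) i).
Proof.
move=> Mg Mh; have Mgh i : M (copair g h i) by case: i.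
have Dgh : definable M (fun x : 'I_k -> U => mulG G g h x).
  exact: definable_param Mgh (definable_mulG G M (inr \o inl) (inr \o inr) inl).
have [|c [Mc /mulGE ghc]] := Tarski_Vaught HM Dgh; last by rewrite -ghc.
by exists (g * h); apply/mulGE.
Qed.

Lemma newelski_S_fs p q : S_fs G M p -> S_fs G M q -> S_fs G M (p ** q).
Proof.
move=> Sp Sq; have [Sp' Sq'] := (S_fs_sub_S_inv Sp, S_fs_sub_S_inv Sq).
have Spq := newelski_S_G Sp' Sq'; split=> //.
apply: fin_sat_in_directed (complete_type_directed Spq.1) _ => phi.
have [B extB Bphi] := exists_over_countable_ext phi.
have [b rb] := exists_gpoint_realizes Sq.1 extB.
move=> /(newelskiE Sp' Sq' extB Bphi rb)/(mostG_fin_sat Sp.1 Sp.2)[g Mg].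
have Bg i : B (g i) by exact: extB.1.
have Dphig := definableG_mull Bg (definableG_holds G Bphi).
move=> /(mostG_realizes_over Sq.1 rb Dphig)/(mostG_fin_sat Sq.1 Sq.2)[h Mh].
by exists (g * h); split=> //; exact: gpoint_mul_model.
Qed.

(** * Right dfg types *)

Section Translates.
Variables (p : set (formula L ('I_k + U))) (Sp : S_G G p).

Lemma rtranslate_S_G c : S_G G (p .* c).
Proof.
apply: (S_G_image (f := fun g => g * c) Sp _ (rtranslateE Sp c)) => Y.
exact: definableG_mulr.
Qed.

Lemma mostG_rtranslate c Y :
  definableG setT Y -> (mostG (p .* c) Y <-> mostG p (fun g => Y (g * c))).
Proof.
apply: (mostG_image (f := fun g => g * c) Sp _ (rtranslateE Sp c)) => Z.
exact: definableG_mulr.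
Qed.

Lemma rtranslateM b c : (p .* b) .* c = p .* (b * c)%g.
Proof.
apply/predeqP => phi; have Dphi := definableG_holds G (over_setT phi).
rewrite (rtranslateE (rtranslate_S_G b)) (rtranslateE Sp).
rewrite mostG_rtranslate; last by apply: (definableG_mulr _ Dphi).
by apply: eq_mostG => g; rewrite mulgA.
Qed.

Lemma rtranslate1 : p .* (1 : gpoint G) = p.
Proof.
apply/predeqP => phi; rewrite rtranslateE // (mostG_holds Sp).
by apply: eq_mostG => g; rewrite mulg1.
Qed.
End Translates.

Definition rdfg_type p : Prop := S_G G p /\ right_dfg G M p.

Lemma rdfg_S_inv p : rdfg_type p -> S_inv G M p.
Proof. by move=> [Sp [dp _]]; split=> //; exact: definable_over_invariant. Qed.

Lemma rdfg_rtranslate p c : rdfg_type p -> rdfg_type (p .* c).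
Proof.
move=> [Sp [dp dpt]]; split; first exact: rtranslate_S_G.
split=> [|d Gd]; first exact/dpt/gtuple_inG.
by rewrite (rtranslateM Sp c (GPoint Gd)); exact/dpt/gtuple_inG.
Qed.

(* The translates by [c] and [c'] are defined by the fibres over [c] and [c']
   of one M-definable relation, and the fibre over [c'] is itself M-definable;
   so the fact that a given M-formula defines it passes from [c'] to [c]. *)
Lemma rtranslate_same_type p c c' :
  rdfg_type p -> same_type M c c' -> p .* c = p .* c'.
Proof.
move=> [Sp [dp dpt]] cc'.
apply: complete_type_eq; [exact: (rtranslate_S_G Sp _).1..|].
move=> phi; have [m [psi [d ->]]] := exists_inst phi.
have [chi [Mchi chiP]] := dpt _ (gtuple_inG c') _ psi.
pose Theta (v : 'I_k + 'I_m -> U) := most p (fun a =>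
  mul_in G (fun x => sat psi (copair x (v \o inr))) a (v \o inl)).
have ThetaE b e : Theta (copair b e) <-> (p .* b) (inst psi e).
  rewrite (rtranslateE Sp) /Theta -(mostG_gtuple Sp).
  by apply: eq_mostG => g; rewrite mul_inE holds_inst.
have DTheta : definable M Theta.
  apply: (definable_most Sp.1 dp (R := fun v => mul_in G (fun x =>
    sat psi (copair x (v \o (inr \o inr)))) (v \o inl) (v \o (inr \o inl)))).
  exact/definable_mul_in_rel/definable_sat.
have Dchi := definable_rename (inr : _ -> 'I_k + _) (definable_holds Mchi).
have [_] := cc' _ (definable_forall (definable_iff DTheta Dchi)).
move=> /(_ (fun e => iff_trans (ThetaE c' e) (chiP e)))/(_ d) Theta_c.
by move=> /ThetaE/Theta_c/chiP.
Qed.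

Lemma newelski_rdfg p q c :
  rdfg_type p -> S_inv G M q -> realizes_over q M c -> p ** q = p .* c.
Proof.
move=> dp Sq rc; have Sp := rdfg_S_inv dp.
apply: complete_type_eq; first exact: newelski_complete.
  exact: (rtranslate_S_G Sp.1 c).1.
move=> phi; have [B extB Bphi] := exists_over_countable_ext phi.
have [b rb] := exists_gpoint_realizes Sq.1 extB.
move=> /(newelskiE Sp Sq extB Bphi rb)/(rtranslateE Sp.1).
rewrite (@rtranslate_same_type p b c) //.
exact: same_type_realizes_over Sq.1.1 (realizes_over_sub extB.1 rb) rc.
Qed.

Section Orbit.
Variables (t : set (formula L ('I_k + U))) (a0 : gpoint G).
Hypotheses (dt : rdfg_type t) (ra0 : realizes_over t M a0).

Definition orbit : set (set (formula L ('I_k + U))) := range (fun g => t .* g).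

Definition orbit_unit : set (formula L ('I_k + U)) := t .* a0^-1.

Lemma orbit_rdfg p : orbit p -> rdfg_type p.
Proof. by move=> [g _ <-]; exact: rdfg_rtranslate. Qed.

Lemma orbit_sub_S_inv : orbit `<=` S_inv G M.
Proof. by move=> p /orbit_rdfg; exact: rdfg_S_inv. Qed.

Lemma orbit_rtranslate p c : orbit p -> orbit (p .* c).
Proof.
by move=> [g _ <-]; exists (g * c); rewrite // rtranslateM //; exact: dt.1.
Qed.

Lemma newelski_rtranslates b c : (t .* b) ** (t .* c) = t .* (b * a0 * c)%g.
Proof.
have [dtb dtc] := (rdfg_rtranslate b dt, rdfg_rtranslate c dt).
have [a ra] := exists_gpoint_realizes dt.1 (countable_ext_range c).
have aa0 : same_type M a a0.
  apply: same_type_realizes_over dt.1.1 (realizes_over_sub _ ra) ra0.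
  exact: subsetUl.
have rac : realizes_over (t .* c) M (a * c)%g.
  move=> X DX; have DGX := definableG_gtuple G DX.
  have Dmulc : definableG (M `|` range c) (fun g => X (g * c)).
    have McX := definableG_sub (@subsetUl _ M (range c)) DGX.
    by apply: (definableG_mulr _ McX) => i; right; exists i.
  rewrite -(mostG_gtuple dtc.1) (mostG_rtranslate dt.1).
    by rewrite -(mostG_realizes_over dt.1 ra Dmulc).
  by apply: definableG_sub DGX; exact: subsetT.
rewrite (newelski_rdfg dtb (rdfg_S_inv dtc) rac) -(rtranslateM dtb.1).
rewrite (rtranslate_same_type dtb aa0) (rtranslateM dt.1 b a0).
by rewrite (rtranslateM dt.1).
Qed.

Lemma newelski_image_eq_orbit : [set t ** q | q in S_inv G M] = orbit.
Proof.
apply/seteqP; split=> [_ [q Sq <-]|_ [g _ <-]].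
  have [c rc] := exists_gpoint_realizes_model Sq.1.
  by exists c => //; rewrite (newelski_rdfg dt Sq rc).
exists (t .* (a0^-1 * g)%g); first exact/rdfg_S_inv/rdfg_rtranslate.
by rewrite -{1}(rtranslate1 dt.1) newelski_rtranslates mul1g mulVKg.
Qed.

Lemma orbit_unit_in_orbit : orbit orbit_unit.
Proof. by exists a0^-1. Qed.

Lemma orbit_unit_newelski p : orbit p -> orbit_unit ** p = p.
Proof. by move=> [g _ <-]; rewrite newelski_rtranslates mulVg mul1g. Qed.

Lemma newelski_orbit_unit p : orbit p -> p ** orbit_unit = p.
Proof. by move=> [g _ <-]; rewrite newelski_rtranslates mulgK. Qed.

Lemma orbit_inverse p : orbit p ->
  exists q, [/\ orbit q, q ** p = orbit_unit & p ** q = orbit_unit].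
Proof.
move=> [g _ <-]; exists (t .* (a0^-1 * g^-1 * a0^-1)%g).
rewrite !newelski_rtranslates; split; first by eexists.
  by rewrite !mulgVK.
by rewrite !mulgA mulgK mulgV mul1g.
Qed.

Lemma orbit_newelski p q : orbit p -> S_inv G M q -> orbit (p ** q).
Proof.
move=> orb_p Sq; have [c rc] := exists_gpoint_realizes_model Sq.1.
by rewrite (newelski_rdfg (orbit_rdfg orb_p) Sq rc); exact: orbit_rtranslate.
Qed.

Lemma ellis_subgroup_orbit :
  ellis_subgroup (newelski G M) (S_inv G M) orbit.
Proof.
apply: (@right_ideal_ellis_subgroup _ _ _ _ orbit_unit).
- exact: orbit_sub_S_inv.
- exact: orbit_unit_in_orbit.
- exact: orbit_unit_newelski.
- exact: newelski_orbit_unit.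
- by move=> p /orbit_inverse[q [orb_q qp _]]; exists q.
- exact: newelski_S_inv.
- exact: newelskiA.
- exact: orbit_newelski.
Qed.
End Orbit.

(** * The map K_M on right dfg types *)

Section TypeInverse.
Variables (p : set (formula L ('I_k + U))) (Sp : S_G G p).

Lemma type_inv_S_G : S_G G (type_inv G p).
Proof. exact: (S_G_image Sp (@definableG_inv _ _ _ G setT) (type_invE Sp)). Qed.

Lemma mostG_type_inv Y :
  definableG setT Y -> (mostG (type_inv G p) Y <-> mostG p (fun g => Y g^-1)).
Proof.
exact: (mostG_image Sp (@definableG_inv _ _ _ G setT) (type_invE Sp)).
Qed.

Lemma type_inv_definable :
  definable_over M p -> definable_over M (type_inv G p).
Proof.
move=> dp n phi.
have Dinv := definable_inv_in_rel G inl inr (definable_sat M phi).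
have /definableP[psi Mpsi psiP] := definable_most Sp.1 dp Dinv.
exists psi; split=> // b; rewrite -psiP (type_invE Sp) -(mostG_gtuple Sp).
by apply: eq_mostG => g; rewrite inv_inE holds_inst.
Qed.
End TypeInverse.

Lemma type_invK p : S_G G p -> type_inv G (type_inv G p) = p.
Proof.
move=> Sp; apply/predeqP => phi; rewrite (type_invE (type_inv_S_G Sp)).
have Dphi := definableG_holds G (over_setT phi).
rewrite (mostG_type_inv Sp (definableG_inv Dphi)) (mostG_holds Sp).
by apply: eq_mostG => g; rewrite invgK.
Qed.

Local Notation K := (K_map M N j G).

Section KMap.
Variable p : set (formula L ('I_k + U)).
Hypotheses (Sp : S_G G p) (dp : definable_over M p).
Let Sip : S_G G (type_inv G p) := type_inv_S_G Sp.
Let dip : definable_over M (type_inv G p) := type_inv_definable Sp dp.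

Lemma K_map_S_fs : S_fs G M (K p).
Proof.
split; last exact: F_map_fin_sat Sip.1 dip.
apply: S_G_intro; first exact: F_map_complete Sip.1 dip.
apply/(most_F_map Sip.1 dip); first exact: definable_sat.
exact: most_inG Sip.
Qed.

Lemma mostG_K_map Y :
  definableG M Y -> (mostG (K p) Y <-> mostG p (fun g => Y g^-1)).
Proof.
move=> DY; have DYT := definableG_sub (@subsetT _ M) DY.
rewrite -(mostG_type_inv Sp DYT); have [X DX YX] := DY.
rewrite !(eq_mostG _ YX) (mostG_gtuple Sip) (mostG_gtuple K_map_S_fs.1).
exact: (most_F_map Sip.1 dip DX).
Qed.
End KMap.

Lemma mostG_newelski_definable s q r Y :
  S_fs G M s -> S_inv G M q -> S_G G r ->
  (forall Z, definableG M Z -> mostG r Z -> mostG q Z) -> definableG M Y ->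
  mostG s (fun g => mostG r (fun h => Y (g * h))) -> mostG (s ** q) Y.
Proof.
move=> Ss Sq Sr rq DY sY; have [b rb] := exists_gpoint_realizes_model Sq.1.
have extM := countable_ext_refl M.
apply/(mostG_newelski (S_fs_sub_S_inv Ss) Sq extM DY rb); apply: contrapT.
have DYb : definableG setT (fun g => Y (g * b)).
  by apply: definableG_mulr (definableG_sub _ DY).
move=> /(mostG_not Ss.1 DYb)/(mostG_and Ss.1 sY)/(mostG_fin_sat Ss.1 Ss.2).
move=> [g Mg [rY]]; apply; have DgY := definableG_mull Mg DY.
by apply/(mostG_realizes_over Sq.1 rb DgY)/rq.
Qed.

(* Both sides are coheirs of the type over [M] of [g * a^-1], where [a]
   realizes [p]. *)
Lemma newelski_K_map s p g :
  S_fs G M s -> rdfg_type p -> realizes_over s M g ->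
  s ** K p = K (p .* g^-1).
Proof.
move=> Ss dfp rg; have [Sp [dp _]] := dfp.
have [Spg [dpg _]] := rdfg_rtranslate g^-1 dfp.
have [Sip Sipg] := (type_inv_S_G Sp, type_inv_S_G Spg).
have [dip dipg] := (type_inv_definable Sp dp, type_inv_definable Spg dpg).
have SK := K_map_S_fs Sp dp; have SsK := newelski_S_fs Ss SK.
apply/esym/(F_map_unique Sipg.1 dipg SsK.1.1 SsK.2) => X DX.
have DGX := definableG_gtuple G DX.
have DGXT := definableG_sub (@subsetT _ M) DGX.
rewrite -(mostG_gtuple Sipg) (mostG_type_inv Spg DGXT).
rewrite (mostG_rtranslate Sp _ (definableG_inv DGXT)) => pX.
apply/(mostG_gtuple SsK.1).
apply: (mostG_newelski_definable Ss (S_fs_sub_S_inv SK) Sip) => // [Z DZ|].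
  rewrite (mostG_K_map Sp dp DZ) mostG_type_inv //.
  exact: definableG_sub DZ.
pose Psi (x : 'I_k -> U) := most (type_inv G p) (fun y => mul_in G X x y).
have DPsi : definable M Psi.
  exact: (definable_most Sip.1 dip (definable_mul_in G inr inl DX)).
have PsiE h : Psi h <-> mostG (type_inv G p) (fun f => X (h * f)).
  by rewrite /Psi -(mostG_gtuple Sip); apply: eq_mostG => f; rewrite mul_inE.
have DGPsi := definableG_gtuple G DPsi.
apply/(eq_mostG s PsiE)/(mostG_realizes_over Ss.1 rg DGPsi).
have DgX := definableG_mull (h := g) (fun=> I) DGXT.
apply/PsiE/(mostG_type_inv Sp DgX).
by apply: mostG_mono pX => h; rewrite invgM invgK.
Qed.

Lemma K_map_newelski p q :
  rdfg_type p -> rdfg_type q -> K (p ** q) = K q ** K p.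
Proof.
move=> dfp dfq; have [Sq [dq _]] := dfq.
have [c rc] := exists_gpoint_realizes_model Sq.
have rcV : realizes_over (K q) M (c^-1)%g.
  move=> X DX; have DGX := definableG_gtuple G DX.
  rewrite -(mostG_gtuple (K_map_S_fs Sq dq).1) (mostG_K_map Sq dq DGX).
  by rewrite -(mostG_realizes_over Sq rc (definableG_inv DGX)).
rewrite (newelski_K_map (K_map_S_fs Sq dq) dfp rcV) invgK.
by rewrite (newelski_rdfg dfp (rdfg_S_inv dfq) rc).
Qed.

Lemma K_map_inj p q : rdfg_type p -> rdfg_type q -> K p = K q -> p = q.
Proof.
move=> [Sp [dp _]] [Sq [dq _]] Kpq.
have [Sip Siq] := (type_inv_S_G Sp, type_inv_S_G Sq).
have [dip diq] := (type_inv_definable Sp dp, type_inv_definable Sq dq).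
rewrite -(type_invK Sp) -(type_invK Sq); congr type_inv.
apply: (definable_types_eq HM Sip.1 Siq.1) => // X DX.
rewrite -(most_F_map Sip.1 dip DX) -(most_F_map Siq.1 diq DX).
by rewrite -/(K p) Kpq.
Qed.

Section KMapOrbit.
Variables (t : set (formula L ('I_k + U))) (a0 : gpoint G).
Hypotheses (dt : rdfg_type t) (ra0 : realizes_over t M a0).

Let orb_rdfg p : orbit t p -> rdfg_type p := @orbit_rdfg t dt p.

Let K_mul p q (orb_p : orbit t p) (orb_q : orbit t q) :
  K (p ** q) = K q ** K p := K_map_newelski (orb_rdfg orb_p) (orb_rdfg orb_q).

Lemma ellis_subgroup_K_map_orbit :
  ellis_subgroup (newelski G M) (S_fs G M) (K @` orbit t).
Proof.
have orb_u := orbit_unit_in_orbit t a0.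
apply: (@left_ideal_ellis_subgroup _ _ _ _ (K (orbit_unit t a0))).
- by move=> _ [p /orb_rdfg[Sp [dp _]] <-]; exact: K_map_S_fs.
- by exists (orbit_unit t a0).
- by move=> _ [p orb_p <-]; rewrite -K_mul // newelski_orbit_unit.
- by move=> _ [p orb_p <-]; rewrite -K_mul // orbit_unit_newelski.
- move=> _ [p orb_p <-]; have [q [orb_q _ pq]] := orbit_inverse dt ra0 orb_p.
  by exists (K q); [exists q|rewrite -K_mul // pq].
- move=> s _ Ss [p orb_p <-]; have [g rg] := exists_gpoint_realizes_model Ss.1.
  rewrite (newelski_K_map Ss (orb_rdfg orb_p) rg).
  by exists (p .* g^-1) => //; exact: orbit_rtranslate.
Qed.

Lemma anti_isomorphism_K_map_orbit :
  anti_isomorphism (newelski G M) (orbit t) (K @` orbit t) K.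
Proof.
split=> [|p q orb_p orb_q]; last exact: K_mul.
split=> // p q; rewrite !inE => orb_p orb_q.
by apply: K_map_inj; exact: orb_rdfg.
Qed.
End KMapOrbit.
End GroupTypes.
End SmallModel.

Theorem theorem4p21 (kappa : Type) (L : language) (T : set (sentence L))
    (U : structure L) (HU : monster_model kappa T U)
    (M : set U) (HM : elem_substructure M) (HMsmall : small kappa M)
    (k : nat) (G : definable_group U k)
    (N' : structure L) (N : set N') (j : U -> N')
    (HN : saturated_pair_extension M N j)
    (HNIP : NIP T) (Hdfg : dfg_group G M)
    (t : set (formula L ('I_k + U)))
    (Ht : S_inv G M t) (Htdfg : right_dfg G M t) :
  let tS := [set newelski G M t q | q in S_inv G M] in
  [/\ ellis_subgroup (newelski G M) (S_inv G M) tS,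
      ellis_subgroup (newelski G M) (S_fs G M) (K_map M N j G @` tS) &
      anti_isomorphism (newelski G M) tS (K_map M N j G @` tS)
        (K_map M N j G)].
Proof.
have [elem_pair _] := HN; have TU := monster_model_of HU.
have satU : saturated (countable_ext M).
  move=> B [MB cB]; apply: (monster_saturated HU); rewrite -(setDUK MB).
  exact: small_setU_countable (monster_aleph0 HU) HMsmall cB.
have dt : rdfg_type M G t by split; first exact: Ht.1.
have [a0 ra0] := exists_gpoint_realizes_model satU Ht.1.
rewrite /= (newelski_image_eq_orbit satU dt ra0); split.
- exact: (ellis_subgroup_orbit satU dt ra0).
- exact: (ellis_subgroup_K_map_orbit HM satU TU HNIP elem_pair dt ra0).
- exact: (anti_isomorphism_K_map_orbit HM satU TU HNIP elem_pair dt).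
Qed.
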